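(* Let $H\in\mathcal N_2$ be a normal affine semigroup in $\mathbb N^2$ and let $\mathbf b$ be its bottom element. If $2\mathbf b\in P_H$, then $\mathbf b$ is the only possible Ulrich element in $B_H$; that is, if $\mathbf b'\in B_H$ is an Ulrich element in $H$, then $\mathbf b'=\mathbf b$.
   Context: $\mathbb N=\{0,1,2,\dots\}$. $\mathcal N_2$ is the class of normal affine semigroups $H\subseteq\mathbb N^2$ generating $\mathbb Z^2$ as a group: $H$ is a finitely generated submonoid of $\mathbb N^2$ with $H=C\cap\mathbb Z^2$, where $C\subseteq\mathbb R^2$ is the (two-dimensional) cone generated by $H$. The extremal rays of $H$ are the primitive lattice vectors $\mathbf a_1,\mathbf a_2\in H$ lying on the two extremal rays of $C$. $P_H=\{\lambda_1\mathbf a_1+\lambda_2\mathbf a_2:0\le\lambda_1,\lambda_2<1\}$. $B_H$ (the Hilbert basis) is the unique minimal generating set of $H$, and $\omega_H=\mathbb Z^2\cap\operatorname{relint}C$. The bottom element of $H$ is the unique element of $\omega_H$ that is minimal (least) in $\omega_H$ for the componentwise order on $\mathbb N^2$ (it always exists). Let $K$ be a field. $R=K[H]$ is the subalgebra of the polynomial ring in two variables over $K$ spanned by the monomials $\mathbf x^{\mathbf h}$, $\mathbf h\in H$; its graded maximal ideal $\mathfrak m$ is generated by $\mathbf x^{\mathbf h}$, $0\ne\mathbf h\in H$. The canonical module $\omega_R$ is the ideal of $R$ spanned over $K$ by the monomials $\mathbf x^{\mathbf h}$, $\mathbf h\in\omega_H$. A graded Cohen–Macaulay $R$-module $E$ is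 Ulrich if its minimal number of generators equals its multiplicity $e(E)$ with respect to $\mathfrak m$; the zero module counts as Ulrich. An element $\mathbf c\in\omega_H$ is called an Ulrich element in $H$ if $\omega_R/\mathbf x^{\mathbf c}R$ is an Ulrich $R$-module. *)

(* Defs.v *)
From HB Require Import structures.
From mathcomp Require Import all_boot all_order all_algebra.
(* mpoly must be imported before MathComp-Analysis: their notations clash in
   the other order. *)
From mathcomp Require Import mpoly.
From mathcomp Require Import boolp classical_sets reals.
From mathcomp Require Import topology normedtype.

Set Implicit Arguments.
Unset Strict Implicit.
Unset Printing Implicit Defensive.

Import Order.TTheory GRing.Theory Num.Theory.
Import numFieldNormedType.Exports.

Local Open Scope classical_set_scope.
Local Open Scope ring_scope.

Section Span.
Variables (A : comNzRingType) (V : lmodType A).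

Definition submod_span (S : set V) : set V := [set x | exists (k : nat)
  (c : 'I_k -> A) (s : 'I_k -> V),
  (forall i, S (s i)) /\ x = \sum_(i < k) c i *: s i].

Definition smul (I : set A) (N : set V) : set V :=
  submod_span [set y | exists a x, [/\ I a, N x & y = a *: x]].

(* [ideal_power_mul I n] is I^n V. *)
Definition ideal_power_mul (I : set A) (n : nat) : set V :=
  iter n (smul I) setT.

Definition annihilator : set A := [set a | forall x : V, a *: x = 0].

End Span.

Section ModuleInvariants.
Variables (A : comNzRingType) (m : set A) (V : lmodType A).

Definition minimal_number_of_generators (n : nat) : Prop :=
  (exists2 s : seq V, size s = n & submod_span [set` s] = setT) /\
  (forall s : seq V, submod_span [set` s] = setT -> (n <= size s)%N).

(* Strictly increasing chains N = M_0 < M_1 < ... < M_l = V of submodules. *)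
Definition submodule_chain (N : set V) (l : nat) : Prop :=
  exists M : nat -> set V,
  [/\ M 0%N = N, M l = setT,
      forall i, (i <= l)%N -> submod_closed (mem (M i)) &
      forall i, (i < l)%N -> M i `<` M i.+1].

(* [colength N l] : the quotient V/N has length l. *)
Definition colength (N : set V) (l : nat) : Prop :=
  submodule_chain N l /\ forall k, submodule_chain N k -> (k <= l)%N.

(* In MathComp, [idealr_closed] includes properness. *)
Definition prime_ideal (P : set A) : Prop :=
  idealr_closed (mem P) /\ prime_idealr_closed (mem P).

Definition prime_chain (d : nat) : Prop :=
  exists P : nat -> set A,
  (forall i, (i <= d)%N -> prime_ideal (P i) /\ annihilator V `<=` P i) /\
  (forall i, (i < d)%N -> P i `<` P i.+1).

Definition krull_dimension (d : nat) : Prop :=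
  prime_chain d /\ forall k, prime_chain k -> (k <= d)%N.

Definition regular_sequence (r : seq A) : Prop :=
  (forall i (x : V), (i < size r)%N ->
     smul [set` take i r] setT (r`_i *: x) ->
     smul [set` take i r] setT x) /\
  smul [set` r] setT <> [set: V].

Definition depth (d : nat) : Prop :=
  (exists r : seq A, [/\ [set` r] `<=` m, regular_sequence r & size r = d]) /\
  (forall r : seq A, [set` r] `<=` m -> regular_sequence r ->
     (size r <= d)%N).

(* For a finitely generated graded module over a positively graded K-algebra
   with graded maximal ideal m, this is equivalent to the Cohen-Macaulay
   property of all localizations. *)
Definition cohen_macaulay : Prop :=
  exists d : nat, krull_dimension d /\ depth d.

(* For V of dimension d, the length of V/m^{n+1}V is, for n large, the value
   at n of a polynomial of degree d with leading coefficient e/d!; this e is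
   the multiplicity of V with respect to m. *)
Definition multiplicity (e : nat) : Prop :=
  exists (d : nat) (p : {poly rat}),
  [/\ krull_dimension d,
      size p = d.+1,
      exists n0 : nat, forall n, (n0 <= n)%N -> exists l : nat,
        colength (ideal_power_mul m n.+1) l /\ p.[n%:R] = l%:R &
      e%:R = (d`!)%:R * lead_coef p].

Definition ulrich : Prop :=
  (forall x : V, x = 0) \/
  (cohen_macaulay /\
   exists n : nat, minimal_number_of_generators n /\ multiplicity n).

End ModuleInvariants.

Section QuotientModule.
Variables (A : comNzRingType) (V : lmodType A) (N : submodClosed V).

(* MathComp's [ideal_quot] quotients by an arbitrary additive subgroup, and
   provides only the additive group structure in that generality. *)
Definition submodule_pred : {pred V} := N.

Fact submodule_zmod_closed : zmod_closed submodule_pred.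
Proof.
split=> [|x y Nx Ny]; first exact: (rpred0 N).
by rewrite -scaleN1r; apply: (rpredD Nx); apply: rpredZ.
Qed.

HB.instance Definition _ :=
  GRing.isZmodClosed.Build V submodule_pred submodule_zmod_closed.

Definition quotient_module : Type := {ideal_quot submodule_pred}.
HB.instance Definition _ := Choice.on quotient_module.
HB.instance Definition _ := GRing.Zmodule.on quotient_module.

Definition quotient_proj (x : V) : quotient_module := \pi_({ideal_quot submodule_pred})%qT x.

Definition quotient_scale (a : A) (q : quotient_module) : quotient_module :=
  quotient_proj (a *: repr (q : {ideal_quot submodule_pred})).

Lemma quotient_projP (x y : V) :
  quotient_proj x = quotient_proj y <-> x - y \in N.
Proof.
rewrite -[x - y \in N]/(x - y \in submodule_pred) Quotient.idealrBE.
by split=> /eqP.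
Qed.

Lemma quotient_projD (x y : V) :
  quotient_proj (x + y) = quotient_proj x + quotient_proj y.
Proof. exact: (Quotient.pi_add submodule_pred). Qed.

Lemma quotient_reprK (q : quotient_module) :
  quotient_proj (repr (q : {ideal_quot submodule_pred})) = q.
Proof. exact: reprK. Qed.

Lemma quotient_projZ (a : A) (x : V) :
  quotient_scale a (quotient_proj x) = quotient_proj (a *: x).
Proof.
apply/quotient_projP; rewrite -scalerBr rpredZ //.
by apply/quotient_projP; rewrite quotient_reprK.
Qed.

Fact quotient_scaleA a b q :
  quotient_scale a (quotient_scale b q) = quotient_scale (a * b) q.
Proof. by rewrite -[q]quotient_reprK !quotient_projZ scalerA. Qed.

Fact quotient_scale1 : left_id 1 quotient_scale.
Proof. by move=> q; rewrite -[q]quotient_reprK quotient_projZ scale1r. Qed.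

Fact quotient_scaleDr : right_distributive quotient_scale +%R.
Proof.
move=> a p q; rewrite -[p]quotient_reprK -[q]quotient_reprK.
by rewrite -quotient_projD !quotient_projZ scalerDr quotient_projD.
Qed.

Fact quotient_scaleDl q : {morph quotient_scale^~ q : a b / a + b}.
Proof.
move=> a b; rewrite -[q]quotient_reprK.
by rewrite !quotient_projZ scalerDl quotient_projD.
Qed.

HB.instance Definition _ := GRing.Zmodule_isLmodule.Build A quotient_module
  quotient_scaleA quotient_scale1 quotient_scaleDr quotient_scaleDl.

End QuotientModule.

Section Convex.
Variables (R : realType) (n : nat).
Implicit Types S C : set 'rV[R]_n.

Definition cone S : set 'rV[R]_n := [set x | exists (k : nat)
  (t : 'I_k -> R) (v : 'I_k -> 'rV[R]_n),
  (forall i, 0 <= t i /\ S (v i)) /\ x = \sum_(i < k) t i *: v i].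

Definition affine_hull S : set 'rV[R]_n := [set x | exists (k : nat)
  (t : 'I_k -> R) (v : 'I_k -> 'rV[R]_n),
  [/\ forall i, S (v i), \sum_(i < k) t i = 1 &
      x = \sum_(i < k) t i *: v i]].

Definition relint S : set 'rV[R]_n := [set x | S x /\
  exists2 e : R, 0 < e & ball x e `&` affine_hull S `<=` S].

Definition ray (v : 'rV[R]_n) : set 'rV[R]_n :=
  [set x | exists2 t : R, 0 <= t & x = t *: v].

(* [v] spans an extremal ray (one-dimensional face) of the cone [C]. *)
Definition spans_extremal_ray C (v : 'rV[R]_n) : Prop :=
  [/\ v != 0, C v &
      forall x y, C x -> C y -> ray v (x + y) -> ray v x /\ ray v y].

Lemma cone_sub S : S `<=` cone S.
Proof.
move=> x Sx; exists 1%N, (fun=> 1), (fun=> x); split=> //.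
by rewrite big_ord1 scale1r.
Qed.

Lemma coneD S x y : cone S x -> cone S y -> cone S (x + y).
Proof.
move=> [k [t [v [tv ->]]]] [l [u [w [uw ->]]]].
pose F (X : Type) (f : 'I_k -> X) (g : 'I_l -> X) (i : 'I_(k + l)) :=
  match split i with inl j => f j | inr j => g j end.
exists (k + l)%N, (F _ t u), (F _ v w); split.
  by move=> i; rewrite /F; case: (split i).
rewrite big_split_ord /=; congr (_ + _); apply: eq_bigr => i _; rewrite /F.
  by rewrite (unsplitK (inl i : 'I_k + 'I_l)).
by rewrite (unsplitK (inr i : 'I_k + 'I_l)).
Qed.

Lemma affine_hull_subD S y z :
  S 0 -> S y -> affine_hull S z -> affine_hull S (z - y).
Proof.
move=> S0 Sy [k [t [v [Sv t1 ->]]]].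
exists k.+2, (fun i => if unlift ord0 i is Some j then
                if unlift ord0 j is Some j' then t j' else 1 else -1),
  (fun i => if unlift ord0 i is Some j then
                if unlift ord0 j is Some j' then v j' else 0 else y); split.
- by move=> i; case: (unlift ord0 i) => // j; case: (unlift ord0 j).
- rewrite !big_ord_recl unlift_none !liftK unlift_none.
  under eq_bigr do rewrite !liftK.
  by rewrite t1 addKr.
rewrite !big_ord_recl unlift_none !liftK unlift_none.
under [in RHS]eq_bigr do rewrite !liftK.
by rewrite scaleN1r scaler0 add0r addrC.
Qed.

Lemma relint_coneD S x y :
  relint (cone S) x -> cone S y -> relint (cone S) (x + y).
Proof.
move=> [Cx [e e0 xe]] Cy; split; first exact: coneD.
exists e => // z [[_ ze] az].
rewrite -(subrK y z); apply: coneD => //; apply: xe; split; last first.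
  apply: affine_hull_subD => //; exists 0%N, (fun=> 0), (fun=> 0).
  by split=> [[]//|]; rewrite big_ord0.
split=> // i j; have := ze i j.
by rewrite /ball /= !mxE opprB addrA.
Qed.

End Convex.

(* Z^n and R^n are row vectors; N^n is the type 'X_{1..n} of exponents. *)
Definition vec (R : pzRingType) (n : nat) (h : 'X_{1..n}) : 'rV[R]_n :=
  \row_(i < n) (h i)%:R.

Lemma vecD (R : pzRingType) (n : nat) (g h : 'X_{1..n}) :
  vec R (g + h)%MM = vec R g + vec R h.
Proof. by apply/rowP=> i; rewrite !mxE mnmDE natrD. Qed.

Record submonoid (n : nat) := Submonoid {
  submonoid_set :> set 'X_{1..n};
  submonoid0 : submonoid_set 0%MM;
  submonoidD : forall g h, submonoid_set g -> submonoid_set h ->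
    submonoid_set (g + h)%MM }.

Section Semigroup.
Variable n : nat.
Implicit Types (H : submonoid n) (B : set 'X_{1..n}).

Definition monoid_generated B : set 'X_{1..n} :=
  [set h | exists2 s : seq 'X_{1..n}, [set` s] `<=` B &
                                      h = (\sum_(g <- s) g)%MM].

Definition finitely_generated H : Prop :=
  exists s : seq 'X_{1..n}, monoid_generated [set` s] = H.

Definition minimal_generating_set H B : Prop :=
  monoid_generated B = H /\
  forall B', B' `<=` B -> monoid_generated B' = H -> B' = B.

Definition group_generated B : set 'rV[int]_n := [set z | exists (k : nat)
  (c : 'I_k -> int) (g : 'I_k -> 'X_{1..n}),
  (forall i, B (g i)) /\ z = \sum_(i < k) vec int (g i) *~ c i].

Section Cone.
Variable R : realType.

Definition semigroup_cone H : set 'rV[R]_n := cone [set vec R h | h in H].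

Definition normal H : Prop :=
  [set z : 'rV[int]_n | semigroup_cone H (map_mx intr z)] =
  [set vec int h | h in H].

(* The cone lies in the nonnegative orthant, so that the lattice points of its
   relative interior are all in N^n. *)
Definition omega H : set 'X_{1..n} :=
  [set h | relint (semigroup_cone H) (vec R h)].

Definition bottom_element H (b : 'X_{1..n}) : Prop :=
  omega H b /\ forall h, omega H h -> (b <= h)%MM.

Definition extremal_ray H (a : 'X_{1..n}) : Prop :=
  [/\ submonoid_set H a, \big[gcdn/0%N]_(i < n) a i = 1%N &
      spans_extremal_ray (semigroup_cone H) (vec R a)].

End Cone.
End Semigroup.

Arguments semigroup_cone {n} R H.
Arguments normal {n} R H.
Arguments omega {n} R H.
Arguments bottom_element {n} R H b.
Arguments extremal_ray {n} R H a.

Definition normal_affine_semigroup2 (R : realType) (H : submonoid 2) : Prop :=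
  [/\ finitely_generated H, group_generated H = setT & normal R H].

Definition fundamental_parallelepiped (R : realType) (a1 a2 : 'X_{1..2}) :
    set 'rV[R]_2 :=
  [set x | exists l1 l2 : R, [/\ 0 <= l1 < 1, 0 <= l2 < 1 &
     x = l1 *: vec R a1 + l2 *: vec R a2]].

Arguments fundamental_parallelepiped R a1 a2 : clear implicits.

Lemma omegaD (R : realType) n (H : submonoid n) g h :
  omega R H g -> submonoid_set H h -> omega R H (g + h)%MM.
Proof.
by move=> wg Hh; rewrite /omega /= vecD; apply: relint_coneD => //;
  apply: cone_sub; exists h.
Qed.

Section SemigroupRing.
Variables (K : fieldType) (n : nat) (H : submonoid n).

Definition semigroup_ring_pred : {pred {mpoly K[n]}} :=
  fun p => `[< forall h, h \in msupp p -> submonoid_set H h >].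

Fact semigroup_ring_subring : subring_closed semigroup_ring_pred.
Proof.
split=> [|p q /asboolP Hp /asboolP Hq|p q /asboolP Hp /asboolP Hq];
  apply/asboolP=> h.
- by rewrite msupp1 inE => /eqP->; exact: submonoid0.
- by move/msuppB_le; rewrite mem_cat => /orP[/Hp|/Hq].
- by move/msuppM_le => /allpairsP[[g1 g2] /= [/Hp h1 /Hq h2 ->]];
    exact: submonoidD.
Qed.

HB.instance Definition _ := GRing.isSubringClosed.Build {mpoly K[n]}
  semigroup_ring_pred semigroup_ring_subring.

Record semigroup_ring := SemigroupRing {
  poly_of :> {mpoly K[n]};
  _ : poly_of \in semigroup_ring_pred }.

HB.instance Definition _ := [isSub for poly_of].
HB.instance Definition _ := [Choice of semigroup_ring by <:].
HB.instance Definition _ := [SubChoice_isSubComNzRing of semigroup_ring by <:].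

Definition graded_maximal_ideal : set semigroup_ring :=
  @submod_span semigroup_ring semigroup_ring^o
    [set p | exists h, [/\ submonoid_set H h, h <> 0%MM & poly_of p = 'X_[h]]].

Variable R : realType.

Definition canonical_pred : {pred semigroup_ring^o} :=
  fun p => `[< forall h, h \in msupp (poly_of p) -> omega R H h >].

Fact canonical_submod : submod_closed canonical_pred.
Proof.
split=> [|r p q /asboolP Hp /asboolP Hq]; apply/asboolP=> h.
  by rewrite msupp0.
move/msuppD_le; rewrite mem_cat => /orP[|/Hq//].
move/msuppM_le => /allpairsP[[g1 g2] /= [h1 /Hp h2 ->]].
have /asboolP Hr := valP r.
by rewrite addmC; apply: omegaD => //; exact: Hr.
Qed.

HB.instance Definition _ := GRing.isSubmodClosed.Build semigroup_ring
  semigroup_ring^o canonical_pred canonical_submod.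

Record canonical_module := CanonicalModule {
  ring_elt_of :> semigroup_ring^o;
  _ : ring_elt_of \in canonical_pred }.

HB.instance Definition _ := [isSub for ring_elt_of].
HB.instance Definition _ := [Choice of canonical_module by <:].
HB.instance Definition _ := [SubChoice_isSubLmodule of canonical_module by <:].

(* x^c R as a submodule of omega_R; it is only used for c in omega_H, when
   x^c R is contained in omega_R. *)
Definition principal_pred (c : 'X_{1..n}) : {pred canonical_module} :=
  fun w => `[< exists r : semigroup_ring,
                 poly_of (ring_elt_of w) = 'X_[c] * poly_of r >].

Fact principal_submod c : submod_closed (principal_pred c).
Proof.
split=> [|r p q /asboolP[a pa] /asboolP[b qb]]; apply/asboolP.
  by exists 0; rewrite mulr0.
by exists (r * a + b); rewrite mulrDr mulrCA -pa -qb.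
Qed.

HB.instance Definition _ c := GRing.isSubmodClosed.Build semigroup_ring
  canonical_module (principal_pred c) (principal_submod c).

Definition ulrich_element (c : 'X_{1..n}) : Prop :=
  omega R H c /\
  ulrich graded_maximal_ideal (quotient_module (principal_pred c)).

End SemigroupRing.

Arguments graded_maximal_ideal K {n} H.
Arguments canonical_pred K {n} H R.
Arguments principal_pred K {n} H R c.
Arguments ulrich_element K {n} H R c.

(* Main.v *)
(* Let l1, l2 be the primitive facet functionals of the cone. For c in omega_H
   the module omega_R / x^c R lives on the lattice lines l_i = v, 0 < v < l_i(c),
   on each of which it is eventually a copy of K[x^{a_i}]; hence its multiplicity
   is (l1(c) - 1) + (l2(c) - 1). It is generated by the first lattice points of
   these lines, so it is not Ulrich as soon as one of them is decomposable.
   If b' <> b is in B_H, then b' - b is not in H, say l1(b') < l1(b); since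
   b <= b' also l2(b') > l2(b). As 2b is in P_H, it is the first point of its
   line parallel to a2, and it is decomposable; so the Ulrich property forces
   2b = b' + f with f in H. Since 2b is in P_H, f is not a multiple of a2, so f
   is in omega_H, whence b <= f and b' <= b. *)
Require Import Defs.
From HB Require Import structures.
From mathcomp Require Import all_boot all_order all_algebra.
From mathcomp Require Import mpoly.
From mathcomp Require Import boolp classical_sets reals.
From mathcomp Require Import topology normedtype.
From mathcomp Require Import zify ring lra.

Set Implicit Arguments.
Unset Strict Implicit.
Unset Printing Implicit Defensive.

Import Order.TTheory GRing.Theory Num.Theory.

Local Open Scope classical_set_scope.
Local Open Scope ring_scope.

(** * Spans and chains of submodules *)

Section Submodules.
Variables (A : comNzRingType) (V : lmodType A).
Implicit Types (S N W : set V).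

(** The obstacle is the multiplicity: it is given through an unknown polynomial whose degree must be
    the Krull dimension. Crude estimates suffice. The length modulo [m^{n+1}] is trapped between two
    linear functions of n of the same slope, and a polynomial with natural values at bounded
    distance from a line is a translate of that line, which fixes its degree and leading coefficient
    at once. The upper estimate counts dimensions over K, since a chain of submodules is no longer
    than a family spanning the quotient over K; the lower one exhibits a chain of monomial
    submodules. In the final argument l2(b') > l2(b), since otherwise b - b' would lie in H and b <=
    b' <= b would give b' = b. The membership of 2b in P_H enters as l1(2b) < d, where d = l1(a2) is
    the determinant of the rays up to sign: otherwise 2b - a2 would lie in H. *)

Lemma submod_span_submod S : submod_closed (mem (submod_span S)).
Proof.
split; first by rewrite !inE; exists 0%N, (fun=> 0), (fun=> 0);
  rewrite big_ord0; split=> // -[].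
move=> a x y; rewrite !inE => -[k [c [s [Ss ->]]]] [l [d [t [St ->]]]].
pose F (X : Type) (f : 'I_k -> X) (g : 'I_l -> X) (i : 'I_(k + l)) :=
  match split i with inl j => f j | inr j => g j end.
exists (k + l)%N, (F _ (fun i => a * c i) d), (F _ s t); split.
  by move=> i; rewrite /F; case: (split i).
rewrite big_split_ord /= scaler_sumr.
congr (_ + _); apply: eq_bigr => i _; rewrite /F.
  by rewrite (unsplitK (inl i : 'I_k + 'I_l)) scalerA.
by rewrite (unsplitK (inr i : 'I_k + 'I_l)).
Qed.

Lemma submod_sum W (I : Type) (r : seq I) (F : I -> V) :
  submod_closed (mem W) -> (forall i, W (F i)) -> W (\sum_(i <- r) F i).
Proof.
move=> [W0 WD] WF; elim: r => [|i r IH]; first by rewrite big_nil -in_setE.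
by rewrite big_cons -in_setE -[F i]scale1r WD // in_setE.
Qed.

Lemma submod_scale W a x : submod_closed (mem W) -> W x -> W (a *: x).
Proof.
by move=> [W0 WD] Wx; rewrite -in_setE -[_ *: _]addr0 WD // in_setE.
Qed.

Lemma submod_span_min S W :
  submod_closed (mem W) -> S `<=` W -> submod_span S `<=` W.
Proof.
move=> subW SW x [k [c [s [Ss ->]]]]; apply: submod_sum => // i.
by apply: submod_scale => //; apply: SW.
Qed.

Lemma submod_span_scale S a x : S x -> submod_span S (a *: x).
Proof.
by move=> Sx; exists 1%N, (fun=> a), (fun=> x); rewrite big_ord1.
Qed.

Lemma chain_mono l (M : nat -> set V) :
  (forall i, (i < l)%N -> M i `<` M i.+1) ->
  forall i j, (i <= j <= l)%N -> M i `<=` M j.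
Proof.
move=> Mlt i j /andP[/subnK<-]; elim: (j - i)%N => [|d IH] dl x Mx //.
by apply: (proj1 (Mlt _ dl)); apply: IH => //; apply: ltnW.
Qed.

(* Vectors picked from the successive steps of the chain are linearly
   independent over K modulo N. *)
Lemma submodule_chain_length_le (K : fieldType) (iota : {rmorphism K -> A})
    (N : set V) (k l : nat) (v : 'I_k -> V) :
  (forall x, exists c : 'I_k -> K, N (x - \sum_j iota (c j) *: v j)) ->
  submodule_chain N l -> (l <= k)%N.
Proof.
move=> spanv [M [M0 Ml Msub Mlt]]; rewrite leqNgt; apply/negP => kl.
have /choice[x xP] : forall i : 'I_l, exists x, M i.+1 x /\ ~ M i x.
  move=> i; have [_ /nonsubset[x [? ?]]] := Mlt i (ltn_ord i).
  by exists x.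
have /choice[c cP] := fun i => spanv (x i).
pose C := \matrix_(i < l, j < k) c i j.
(* As [k < l], the coefficient rows of the [x i] are dependent; the relation [u] combines the [x i]
   into an element of [N]. *)
have /rowV0Pn[u /sub_kermxP uC u0] : kermx C != 0.
  rewrite -mxrank_eq0 mxrank_ker subn_eq0 -ltnNge.
  exact: leq_ltn_trans (rank_leq_col _) kl.
have NS : submod_closed (mem N) by rewrite -M0; apply: Msub.
have Nu : N (\sum_i iota (u ord0 i) *: x i).
  have -> : \sum_i iota (u ord0 i) *: x i =
      \sum_i iota (u ord0 i) *: (x i - \sum_j iota (c i j) *: v j).
    under [RHS]eq_bigr do rewrite scalerBr scaler_sumr.
    rewrite sumrB exchange_big /= [X in _ - X]big1 ?subr0 // => j _.
    under eq_bigr do rewrite scalerA.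
    rewrite -scaler_suml -[RHS](scale0r (v j)); congr (_ *: _).
    transitivity (iota ((u *m C) ord0 j)); last by rewrite uC mxE rmorph0.
    by rewrite mxE rmorph_sum; apply: eq_bigr => i _; rewrite mxE rmorphM.
  by apply: submod_sum => // i; apply: submod_scale => //; apply: cP.
have [i0 ui0] : exists i, u ord0 i != 0.
  apply/existsP; apply: contraNT u0; rewrite negb_exists => /forallP u0.
  by apply/eqP/rowP => i; rewrite mxE; apply/eqP; rewrite -[_ == _]negbK.
(* At the last index with a nonzero coefficient, the relation expresses [x i] through [N] and
   earlier [x j], all inside [M i]. *)
have [i ui imax] := @arg_maxnP _ i0 (fun i => u ord0 i != 0) val ui0.
have Mi := Msub i (ltnW (ltn_ord i)).
have mono := chain_mono Mlt.
apply: (proj2 (xP i)).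
have -> : x i = iota (u ord0 i)^-1 *: (\sum_i iota (u ord0 i) *: x i
    - \sum_(j | j != i) iota (u ord0 j) *: x j).
  by rewrite (bigD1 i) //= addrK scalerA -rmorphM mulVf // rmorph1 scale1r.
apply: submod_scale => //; rewrite -in_setE -scaleN1r addrC.
apply: (proj2 Mi); rewrite ?in_setE; last first.
  by apply: (mono 0%N) => //; rewrite ?M0 //= ltnW.
rewrite big_mkcond; apply: submod_sum => // j; case: eqVneq => [_|ji] /=.
  by rewrite -in_setE; case: Mi.
have [->|uj] := eqVneq (u ord0 j) 0.
  by rewrite rmorph0 scale0r -in_setE; case: Mi.
apply: submod_scale => //; apply: (mono j.+1) (proj1 (xP j)) => //.
have jlei : (j <= i)%N := imax _ uj.
by rewrite ltn_neqAle jlei andbT (ltnW (ltn_ord i)) andbT.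
Qed.

End Submodules.

(* p - aX takes finitely many values at the integers n >= n0, so one of its
   translates by these values has infinitely many roots. *)
Lemma bounded_natvalued_poly_affine (p : {poly rat}) (a n0 M : nat) :
  (forall n, (n0 <= n)%N -> exists l : nat,
     p.[n%:R] = l%:R /\ (a * n <= l + M)%N /\ (l <= a * n + M)%N) ->
  exists j : rat, p = a%:R *: 'X + j%:P.
Proof.
move=> pP; pose q := p - a%:R *: 'X + M%:R%:P.
have qP n : (n0 <= n)%N -> exists2 j : 'I_(M + M).+1, true & q.[n%:R] = (val j)%:R.
  move=> /pP[l [pl [lo hi]]].
  have lt : (l + M - a * n < (M + M).+1)%N by lia.
  exists (Ordinal lt) => //=; rewrite !hornerE pl natrB // natrD natrM.
  by ring.
(* Pigeonhole in algebraic form: [Q] vanishes at [size Q] distinct integers, hence is zero, and so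
   is one of its factors. *)
pose Q := \prod_(j < (M + M).+1) (q - (val j)%:R%:P).
have : Q = 0.
  apply/eqP; apply: contraT => Q0.
  pose rs := [seq (n%:R : rat) | n <- iota n0 (size Q)].
  have := @max_poly_roots _ Q rs Q0; rewrite size_map size_iota ltnn; apply.
    apply/allP => z /mapP[n]; rewrite mem_iota => /andP[n0n _] ->.
    have [j _ qj] := qP _ n0n.
    by rewrite /root /Q horner_prod (bigD1 j) //= hornerD hornerN hornerC qj subrr mul0r.
  rewrite map_inj_uniq ?iota_uniq // => x y /eqP.
  by rewrite eqr_nat => /eqP.
move/eqP/prodf_eq0 => [j _]; rewrite subr_eq0 => /eqP qj.
exists ((val j)%:R - M%:R); rewrite rmorphB /= -qj /q.
by rewrite addrK addrC subrK.
Qed.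

(** If [g] and [h] are nonzero, both have smaller degree than [g + h], so their decompositions avoid
    [g + h], which is then redundant in [B]. *)
Lemma minimal_generating_set_indecomposable n (H : submonoid n)
    (B : set 'X_{1..n}) (g h : 'X_{1..n}) :
  minimal_generating_set H B -> submonoid_set H g -> submonoid_set H h ->
  B (g + h)%MM -> g = 0%MM \/ h = 0%MM.
Proof.
move=> [genB minB] Hg Hh Bgh; apply: contrapT => /not_orP[/eqP g0 /eqP h0].
pose B' := B `\ (g + h)%MM.
have B'0 : monoid_generated B' 0%MM by exists [::]; rewrite ?big_nil.
have B'D x y : monoid_generated B' x -> monoid_generated B' y ->
    monoid_generated B' (x + y)%MM.
  move=> [s sB ->] [t tB ->]; exists (s ++ t); last by rewrite big_cat.
  by move=> z /=; rewrite mem_cat => /orP[/sB|/tB].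
have small x : submonoid_set H x -> (mdeg x < mdeg (g + h)%MM)%N ->
    monoid_generated B' x.
  rewrite -genB => -[s sB ->] deg; exists s => // z zs; split; first exact: sB.
  move=> zE; move: deg; rewrite (big_rem z) //= zE mdegD.
  by lia.
have gh : monoid_generated B' (g + h)%MM.
  have := mdeg_eq0 g; have := mdeg_eq0 h.
  rewrite (negPf g0) (negPf h0) => h1 g1.
  by apply: B'D; apply: small => //; rewrite mdegD; lia.
have : B' = B.
  apply: minB; first by move=> x [].
  rewrite -genB; apply/seteqP; split=> x [s sB ->].
    by exists s => // z /sB[].
  elim: s sB => [|z s IH] sB; first by rewrite big_nil.
  rewrite big_cons; apply: B'D; last first.
    by apply: IH => y ys; apply: sB; rewrite /= inE ys orbT.
  have Bz : B z by apply: sB; rewrite /= inE eqxx.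
  have [->|zgh] := eqVneq z (g + h)%MM; first by [].
  exists [:: z]; last by rewrite big_seq1.
  by move=> y /=; rewrite inE => /eqP->; split=> //; apply/eqP.
by move=> BB; have := Bgh; rewrite -BB => -[_]; apply.
Qed.

Lemma submonoid_mulmn n (H : submonoid n) g k :
  submonoid_set H g -> submonoid_set H (g *+ k)%MM.
Proof.
move=> Hg; elim: k => [|k IH]; rewrite ?mulm0n ?mulmS.
  exact: submonoid0.
exact: submonoidD.
Qed.

(** * Planar cones and facet functionals *)

Definition cross (T : pzRingType) (u v : 'rV[T]_2) : T :=
  u 0 0 * v 0 1 - u 0 1 * v 0 0.

Lemma cross_vec (T : comNzRingType) (g h : 'X_{1..2}) :
  cross (vec T g) (vec T h) = (cross (vec int g) (vec int h))%:~R.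
Proof. by rewrite /cross !mxE rmorphB !rmorphM /= !rmorph_nat. Qed.

Lemma ord2_neq0 (i : 'I_2) : i != 0 -> i = 1.
Proof. by move=> i0; apply/val_inj; case: i i0 => [[|[|]]]. Qed.

Lemma row2P (T : Type) (u v : 'rV[T]_2) :
  u 0 0 = v 0 0 -> u 0 1 = v 0 1 -> u = v.
Proof.
move=> uv0 uv1; apply/rowP => i; have [->//|i0] := eqVneq i 0.
by rewrite (ord2_neq0 i0).
Qed.

Lemma cramer2 (T : comNzRingType) (u v w : 'rV[T]_2) :
  cross u v *: w = cross w v *: u + cross u w *: v.
Proof. by apply: row2P; rewrite /cross !mxE; ring. Qed.

Lemma primitive_bezout (a : 'X_{1..2}) :
  \big[gcdn/0%N]_(i < 2) a i = 1%N ->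
  exists u v : int, u * (a 0)%:Z + v * (a 1)%:Z = 1.
Proof.
rewrite !big_ord_recl big_ord0 gcdn0 => a1.
have [u [v uv]] := Bezoutz (a 0) (a 1); exists u, v; rewrite uv.
have -> : (1 : 'I_2) = lift ord0 ord0 by apply/val_inj.
by rewrite -[0%R]/ord0 /gcdz !absz_nat a1.
Qed.

(** A Bezout relation [u * a 0 + v * a 1 = 1] forces the multiplier to be [u * f 0 + v * f 1], an
    integer; it is nonnegative because the coordinates are natural and [a] is nonzero. *)
Lemma primitive_cross0 (a f : 'X_{1..2}) :
  \big[gcdn/0%N]_(i < 2) a i = 1%N ->
  cross (vec int a) (vec int f) = 0 -> exists k : nat, f = (a *+ k)%MM.
Proof.
move=> /primitive_bezout[u [v uv]]; rewrite /cross !mxE !natz => af.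
pose k : int := u * (f 0)%:Z + v * (f 1)%:Z.
have f0 : (f 0)%:Z = (a 0)%:Z * k.
  rewrite -[LHS]mul1r -uv /k; apply/eqP; rewrite -subr_eq0; apply/eqP.
  transitivity (- v * ((a 0)%:Z * (f 1)%:Z - (a 1)%:Z * (f 0)%:Z)); first by ring.
  by rewrite af mulr0.
have f1 : (f 1)%:Z = (a 1)%:Z * k.
  rewrite -[LHS]mul1r -uv /k; apply/eqP; rewrite -subr_eq0; apply/eqP.
  transitivity (u * ((a 0)%:Z * (f 1)%:Z - (a 1)%:Z * (f 0)%:Z)); first by ring.
  by rewrite af mulr0.
have k0 : 0 <= k.
  move: (a 0) (a 1) (f 0) (f 1) k f0 f1 uv {af} => a0 a1 m0 m1 k f0 f1 uv.
  rewrite leNgt; apply/negP => kneg.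
  have a00 : a0 = 0%N by nia.
  have a10 : a1 = 0%N by nia.
  by move: uv; rewrite a00 a10 !mulr0.
exists `|k|%N.
have H i : (f i)%:Z = (a i)%:Z * k.
  have [->//|i0] := eqVneq i 0.
  by rewrite (ord2_neq0 i0).
apply/mnmP => i; rewrite mulmnE.
by move: (f i) (a i) (H i) k0 => fi ai; lia.
Qed.

Lemma primitive_cross_neq0 (a1 a2 : 'X_{1..2}) :
  \big[gcdn/0%N]_(i < 2) a1 i = 1%N -> \big[gcdn/0%N]_(i < 2) a2 i = 1%N ->
  a1 <> a2 -> cross (vec int a1) (vec int a2) != 0.
Proof.
move=> p1 p2 a12; apply/eqP => c0; apply: a12.
have c0' : cross (vec int a2) (vec int a1) = 0.
  by rewrite -oppr0 -c0 /cross; ring.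
have [k ka] := primitive_cross0 p1 c0.
have [k' ka'] := primitive_cross0 p2 c0'.
have k1 : (k * k' = 1)%N.
  have [i ai] : exists i, (0 < a1 i)%N.
    apply: contrapT => /forallNP a0; move: p1; rewrite big1 // => i _.
    by have := a0 i; rewrite lt0n => /negP; rewrite negbK => /eqP.
  apply/eqP; rewrite -(eqn_pmul2l ai) muln1 mulnA -!mulmnE.
  by rewrite -ka -ka'.
have /eqP := k1; rewrite muln_eq1 => /andP[/eqP kE _].
by rewrite ka kE.
Qed.

(* [eps = 1] and [eps = -1] give the statement for both orders of the two
   rays. *)
Lemma lattice_line_point (a b : 'X_{1..2}) (eps d v : int) :
  \big[gcdn/0%N]_(i < 2) a i = 1%N -> eps * eps = 1 ->
  eps * cross (vec int a) (vec int b) = d -> 0 < d ->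
  exists z : 'rV[int]_2, eps * cross (vec int a) z = v /\
    0 < eps * cross z (vec int b) <= d.
Proof.
move=> /primitive_bezout[u [w uw]] eps1 ed d0.
pose z0 : 'rV[int]_2 :=
  \row_(i < 2) (if i == 0 then - (eps * v * w) else eps * v * u).
(* The [- 1] moves the remainder from [[0, d)] to the required range [(0, d]]. *)
pose t := eps * cross z0 (vec int b) - 1.
have tE := divz_eq t d; set q := (t %/ d)%Z in tE.
have [t0 td] : 0 <= (t %% d)%Z /\ (t %% d)%Z < d.
  by rewrite modz_ge0 ?ltz_pmod ?gt_eqF.
exists (z0 - q *: vec int a); split.
  rewrite /cross !mxE !natz /=.
  transitivity (eps * eps * v * (u * (a 0)%:Z + w * (a 1)%:Z)); first by ring.
  by rewrite eps1 uw mulr1 mul1r.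
have -> : eps * cross (z0 - q *: vec int a) (vec int b) =
    eps * cross z0 (vec int b) - q * (eps * cross (vec int a) (vec int b)).
  by rewrite /cross !mxE; ring.
rewrite ed; have -> : eps * cross z0 (vec int b) = t + 1 by rewrite /t subrK.
have -> : t + 1 - q * d = (t %% d)%Z + 1 by rewrite [in LHS]tE; ring.
by move: (t %% d)%Z t0 td => r; lia.
Qed.

Section Cone2.
Variables (R : realType) (H : submonoid 2).
Implicit Types (a f g h : 'X_{1..2}) (x y z : 'rV[R]_2).
Let C : set 'rV[R]_2 := semigroup_cone R H.

Lemma semigroup_cone_vec h : submonoid_set H h -> C (vec R h).
Proof. by move=> Hh; apply: cone_sub; exists h. Qed.

Lemma semigroup_cone_scale x (t : R) : 0 <= t -> C x -> C (t *: x).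
Proof.
move=> t0 [k [c [v [cv ->]]]]; exists k, (fun i => t * c i), v; split.
  by move=> i; have [c0 ?] := cv i; rewrite mulr_ge0.
by rewrite scaler_sumr; apply: eq_bigr => i _; rewrite scalerA.
Qed.

Lemma semigroup_cone_ge0 x i : C x -> 0 <= x 0 i.
Proof.
move=> [k [c [v [cv ->]]]]; rewrite summxE; apply: sumr_ge0 => j _.
have [c0 [h _ vE]] := cv j.
by rewrite !mxE mulr_ge0 // -vE mxE ler0n.
Qed.

(* If x lay beyond the ray of a, then a would be a positive combination of x
   and of c, a point on the other side, contradicting extremality. *)
Lemma extremal_ray_side a c x : spans_extremal_ray C (vec R a) ->
  submonoid_set H c -> C x ->
  0 <= cross (vec R a) (vec R c) * cross (vec R a) x.
Proof.
move=> [a0 _ ext] Hc Cx; rewrite leNgt; apply/negP => neg.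
set s := cross (vec R a) (vec R c) in neg.
(* Cramer's relation between [a], [c] and [x], multiplied by [s], becomes [E]: [s * s] is a square,
   [r] is positive by [neg], and [t] is nonnegative because the cone lies in the orthant. *)
pose r := s * cross x (vec R a).
have r0 : 0 < r.
  suff -> : r = - (s * cross (vec R a) x) by rewrite oppr_gt0.
  by rewrite /r /cross; ring.
pose t := s * cross x (vec R c).
have E : (s * s) *: x + r *: vec R c = t *: vec R a.
  rewrite -scalerA [s *: x]cramer2 /r /t scalerDr !scalerA -addrA -scalerDl.
  rewrite [X in _ + X *: _](_ : _ = 0) ?scale0r ?addr0 //.
  by rewrite /cross; ring.
have C1 : C ((s * s) *: x) by apply: semigroup_cone_scale; rewrite // -expr2 sqr_ge0.
have C2 : C (r *: vec R c).
  by apply: semigroup_cone_scale; [exact: ltW | exact: semigroup_cone_vec].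
have [i ai] : exists i, vec R a 0 i != 0.
  apply/existsP; apply: contraNT a0; rewrite negb_exists => /forallP a0.
  by apply/eqP/rowP => i; have := a0 i; rewrite negbK => /eqP->; rewrite mxE.
have t0 : 0 <= t.
  have ai0 : 0 < vec R a 0 i by rewrite lt_neqAle eq_sym ai mxE ler0n.
  rewrite -(pmulr_lge0 _ ai0).
  have -> : t * vec R a 0 i = (t *: vec R a) 0 i by rewrite [RHS]mxE.
  rewrite -E; apply: semigroup_cone_ge0.
  exact: coneD.
have [_ [w w0 rw]] := ext _ _ C1 C2 (ex_intro2 _ _ t t0 E).
have : cross (vec R a) (r *: vec R c) = r * s.
  by rewrite /s /cross !mxE; ring.
rewrite rw (_ : cross _ _ = 0); last by rewrite /cross !mxE; ring.
move/esym/eqP; rewrite mulf_eq0 gt_eqF //= => /eqP s0.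
by move: neg; rewrite s0 mul0r ltxx.
Qed.

Section OrientedRays.
Variables a1 a2 : 'X_{1..2}.
Hypotheses (Ha1 : submonoid_set H a1) (Ha2 : submonoid_set H a2).
Hypotheses (ext1 : spans_extremal_ray C (vec R a1))
           (ext2 : spans_extremal_ray C (vec R a2)).
Hypothesis (d_gt0 : 0 < cross (vec R a1) (vec R a2)).

(** Extremality confines the cone to one side of each ray, and the other ray tells which side.
    Conversely, Cramer's rule expresses [x] in [a1] and [a2] with the two cross products over the
    determinant as coefficients. *)
Lemma semigroup_cone2E x :
  C x <-> 0 <= cross (vec R a1) x /\ 0 <= cross x (vec R a2).
Proof.
split=> [Cx|[x1 x2]].
  split; first by have := extremal_ray_side ext1 Ha2 Cx; rewrite pmulr_rge0.
  have := extremal_ray_side ext2 Ha1 Cx.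
  rewrite (_ : _ * _ = cross (vec R a1) (vec R a2) * cross x (vec R a2)).
    by rewrite pmulr_rge0.
  by rewrite /cross; ring.
pose d := cross (vec R a1) (vec R a2); have d0 : 0 < d := d_gt0.
have -> : x = d^-1 *: (cross x (vec R a2) *: vec R a1 + cross (vec R a1) x *: vec R a2).
  by rewrite -cramer2 scalerA mulVf ?scale1r ?gt_eqF.
apply: semigroup_cone_scale; first by rewrite invr_ge0 ltW.
by apply: coneD; apply: semigroup_cone_scale => //; apply: semigroup_cone_vec.
Qed.

(** From a relative interior point one can step back along either ray without leaving the cone,
    which lowers the functional vanishing on the other ray by a positive amount. Conversely, small
    changes of the coordinates keep both functionals nonnegative. *)
Lemma relint_semigroup_cone2E x : relint C x <->
  0 < cross (vec R a1) x /\ 0 < cross x (vec R a2).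
Proof.
pose d := cross (vec R a1) (vec R a2); have d0 : 0 < d := d_gt0.
split=> [[Cx [e e0 sub]]|[x1 x2]].
  have Cv i : C (vec R (if i then a1 else a2)).
    by apply: semigroup_cone_vec; case: i.
  have C0 : C 0 by exists 0%N, (fun=> 0), (fun=> 0); rewrite big_ord0; split=> // -[].
  have key i : exists2 t : R, 0 < t & C (x - t *: vec R (if i then a1 else a2)).
    set w := vec R _.
    have w0 j : 0 <= w 0 j by rewrite mxE ler0n.
    (* The denominator exceeds each coordinate of [w], so the step [t *: w] stays inside the open
       ball of radius [e]. *)
    pose t := e / (1 + w 0 0 + w 0 1).
    have den : 0 < 1 + w 0 0 + w 0 1 by have := w0 0; have := w0 1; lra.
    have t0 : 0 < t by rewrite divr_gt0.
    have te : t * (1 + w 0 0 + w 0 1) = e by rewrite divfK ?gt_eqF.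
    exists t => //; apply: sub; split.
      split=> // j k; rewrite /ball /= !ord1.
      have -> : x 0 k - (x - t *: w) 0 k = t * w 0 k.
        by rewrite !mxE opprB addrC subrK.
      have tw0 : 0 <= t * w 0 k by rewrite mulr_ge0 ?w0 ?(ltW t0).
      rewrite (ger0_norm tw0) -[ltRHS]te ltr_pM2l //.
      have [->|k0] := eqVneq k 0; first by have := w0 1; lra.
      rewrite (ord2_neq0 k0).
      by have := w0 0; lra.
    (* The zero vector takes the coefficient [t] to make the coefficients sum to 1. *)
    exists 3%N, (fun i => nth 0 [:: 1; - t; t] i), (fun i => nth 0 [:: x; w; 0] i).
    split.
    - case=> [[|[|[|]]]] //= _; exact: Cv.
    - by rewrite !big_ord_recl big_ord0 /=; ring.
    - by rewrite !big_ord_recl big_ord0 /= scaler0 !addr0 scale1r scaleNr.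
  have /semigroup_cone2E[x1 x2] := Cx; split.
    have [t t0 /semigroup_cone2E[] + _] := key false.
    rewrite (_ : cross _ _ = cross (vec R a1) x - t * d).
      by have := mulr_gt0 t0 d0; lra.
    by rewrite /d /cross !mxE; ring.
  have [t t0 /semigroup_cone2E[] _] := key true.
  rewrite (_ : cross _ _ = cross x (vec R a2) - t * d).
    by have := mulr_gt0 t0 d0; lra.
  by rewrite /d /cross !mxE; ring.
split; first by apply/semigroup_cone2E; split; apply: ltW.
(* [m] exceeds the sum of the coefficients of either functional, so moving each coordinate by less
   than [e] changes it by at most [e * m]. *)
pose m := 1 + (vec R a1 0 0 + vec R a1 0 1) + (vec R a2 0 0 + vec R a2 0 1).
have pos (i : 'I_2) a : 0 <= vec R a 0 i by rewrite mxE ler0n.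
have m1 : 0 < m.
  have := (pos 0 a1, pos 1 a1, (pos 0 a2, pos 1 a2)).
  by move=> [[? ?] [? ?]]; rewrite /m; lra.
pose e := Num.min (cross (vec R a1) x) (cross x (vec R a2)) / m.
have e0 : 0 < e by rewrite divr_gt0 // lt_min x1 x2.
have em : e * m = Num.min (cross (vec R a1) x) (cross x (vec R a2)).
  by rewrite divfK ?gt_eqF.
have [e1 e2] : e * m <= cross (vec R a1) x /\ e * m <= cross x (vec R a2).
  by rewrite em !ge_min !lexx orbT.
move: e e0 e1 e2 {em x1 x2} => e e0 e1 e2; exists e => // z [[_ xz] _].
have := xz 0 0; have := xz 0 1; rewrite /ball /= !ltr_norml.
move=> /andP[y1 y1'] /andP[y0 y0'].
have := (pos 0 a1, pos 1 a1, (pos 0 a2, pos 1 a2)).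
move: e1 e2 y0 y0' y1 y1'; rewrite semigroup_cone2E /cross /m.
move: (vec R a1 0 0) (vec R a1 0 1) (vec R a2 0 0) (vec R a2 0 1).
move: (x 0 0) (x 0 1) (z 0 0) (z 0 1) => x0 x1 z0 z1.
move=> p q r s e1 e2 y1 y2 y3 y4 [[p0 q0] [r0 s0]].
have prod u v : 0 <= u -> 0 <= v -> 0 <= u * v by exact: mulr_ge0.
split.
  (* The functional at [z] is its value at [x], minus [e * m], plus these three nonnegative
     terms. *)
  have h1 : 0 <= p * (e - (x1 - z1)) by apply: prod => //; lra.
  have h2 : 0 <= q * (e + (x0 - z0)) by apply: prod => //; lra.
  have h3 : 0 <= e * (1 + (r + s)) by apply: prod; lra.
  by nra.
have h1 : 0 <= s * (e - (x0 - z0)) by apply: prod => //; lra.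
have h2 : 0 <= r * (e + (x1 - z1)) by apply: prod => //; lra.
have h3 : 0 <= e * (1 + (p + q)) by apply: prod; lra.
by nra.
Qed.

End OrientedRays.
End Cone2.

(* [l1] and [l2] are the two primitive facet functionals of the cone, made
   nat-valued by an absolute value: they are meaningful on H only. *)
Record facet_coordinates (R : realType) (H : submonoid 2) (a1 a2 : 'X_{1..2})
    (l1 l2 : 'X_{1..2} -> nat) (d : nat) : Prop := FacetCoordinates {
  facet_d_gt0 : (0 < d)%N;
  facet_ray1 : [/\ submonoid_set H a1, l1 a1 = 0%N & l2 a1 = d];
  facet_ray2 : [/\ submonoid_set H a2, l1 a2 = d & l2 a2 = 0%N];
  facetD : forall g h, submonoid_set H g -> submonoid_set H h ->
    l1 (g + h)%MM = (l1 g + l1 h)%N /\ l2 (g + h)%MM = (l2 g + l2 h)%N;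
  facet_omega : forall h,
    omega R H h <-> [/\ submonoid_set H h, (0 < l1 h)%N & (0 < l2 h)%N];
  facet_le : forall g h, submonoid_set H g -> submonoid_set H h ->
    (l1 g <= l1 h)%N -> (l2 g <= l2 h)%N ->
    exists2 f, submonoid_set H f & h = (g + f)%MM;
  facet_line1 : forall f, submonoid_set H f -> l1 f = 0%N ->
    exists k, f = (a1 *+ k)%MM;
  facet_line2 : forall f, submonoid_set H f -> l2 f = 0%N ->
    exists k, f = (a2 *+ k)%MM;
  facet_point1 : forall v, (0 < v)%N ->
    exists h, [/\ submonoid_set H h, l1 h = v & (0 < l2 h <= d)%N];
  facet_point2 : forall v, (0 < v)%N ->
    exists h, [/\ submonoid_set H h, l2 h = v & (0 < l1 h <= d)%N] }.

(** Lets each later statement about lines parallel to [a1] serve for [a2] as well. *)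
Lemma facet_coordinates_sym (R : realType) H a1 a2 l1 l2 d :
  facet_coordinates R H a1 a2 l1 l2 d -> facet_coordinates R H a2 a1 l2 l1 d.
Proof.
case=> d0 [Ha1 l1a1 l2a1] [Ha2 l1a2 l2a2] lD om sub r1 r2 p1 p2; split=> //.
- by move=> g h Hg Hh; have [-> ->] := lD g h Hg Hh.
- by move=> h; rewrite om; split=> -[].
- by move=> g h Hg Hh *; apply: sub.
Qed.

Lemma facet_coordinates_oriented (R : realType) (H : submonoid 2)
    (a1 a2 : 'X_{1..2}) :
  normal R H -> extremal_ray R H a1 -> extremal_ray R H a2 ->
  0 < cross (vec int a1) (vec int a2) ->
  facet_coordinates R H a1 a2
    (fun h => `|cross (vec int a1) (vec int h)|%N)
    (fun h => `|cross (vec int h) (vec int a2)|%N)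
    `|cross (vec int a1) (vec int a2)|%N.
Proof.
move=> norH [Ha1 pr1 ext1] [Ha2 pr2 ext2] d0.
have dR : 0 < cross (vec R a1) (vec R a2) by rewrite (cross_vec R) ltr0z.
have coneE := semigroup_cone2E Ha1 Ha2 ext1 ext2 dR.
have relE := relint_semigroup_cone2E Ha1 Ha2 ext1 ext2 dR.
(* Normality enters here: lattice points on the right side of both rays come from [H], which yields
   every existence field of the record. *)
have lift z : 0 <= cross (vec int a1) z -> 0 <= cross z (vec int a2) ->
    exists2 h, submonoid_set H h & vec int h = z.
  move=> z1 z2; have : [set vec int h | h in H] z.
    rewrite -norH /= coneE.
    have -> : vec R a1 = map_mx intr (vec int a1).
      by apply/rowP => i; rewrite !mxE rmorph_nat.
    have -> : vec R a2 = map_mx intr (vec int a2).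
      by apply/rowP => i; rewrite !mxE rmorph_nat.
    have crE (u v : 'rV[int]_2) :
        cross (map_mx intr u) (map_mx intr v) = (cross u v)%:~R :> R.
      by rewrite /cross !mxE rmorphB !rmorphM.
    by rewrite !crE !ler0z.
  by case=> h; exists h.
have ge0 h : submonoid_set H h ->
    0 <= cross (vec int a1) (vec int h) /\ 0 <= cross (vec int h) (vec int a2).
  move=> Hh; have /coneE := semigroup_cone_vec R Hh.
  by rewrite !(cross_vec R) !ler0z.
have crD u g h : cross u (vec int (g + h)%MM) =
    cross u (vec int g) + cross u (vec int h).
  by rewrite vecD /cross !mxE; ring.
have crD' u g h : cross (vec int (g + h)%MM) u =
    cross (vec int g) u + cross (vec int h) u.
  by rewrite vecD /cross !mxE; ring.
have cc u : cross u u = 0 :> int by rewrite /cross; ring.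
have abs (x y : int) : 0 <= x -> 0 <= y ->
    `|(x + y)%R|%N = (`|x| + `|y|)%N by lia.
have abs_le (x y : int) : 0 < x -> x <= y -> (`|x| <= `|y|)%N by lia.
have gt0E (x : int) : 0 <= x -> (0 < `|x|)%N = (0 < x) by lia.
split.
- by rewrite absz_gt0 (gt_eqF d0).
- by split; rewrite ?cc.
- by split; rewrite ?cc.
- move=> g h /ge0[g1 g2] /ge0[h1 h2].
  by rewrite crD crD' (abs _ _ g1 h1) (abs _ _ g2 h2).
- move=> h; rewrite /omega /= relE !(cross_vec R) !ltr0z; split.
    move=> [h1 h2]; have [g Hg gh] := lift _ (ltW h1) (ltW h2).
    have -> : h = g.
      apply/mnmP => i; have /rowP/(_ i) := gh; rewrite !mxE => /eqP.
      by rewrite eqr_nat => /eqP.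
    by rewrite gh; split=> //; rewrite gt0E // ltW.
  by move=> [/ge0[h1 h2]]; rewrite !gt0E.
- move=> g h Hg Hh le1 le2; have [g1 g2] := ge0 g Hg; have [h1 h2] := ge0 h Hh.
  have crB1 : cross (vec int a1) (vec int h - vec int g) =
      cross (vec int a1) (vec int h) - cross (vec int a1) (vec int g).
    by rewrite /cross !mxE; ring.
  have crB2 : cross (vec int h - vec int g) (vec int a2) =
      cross (vec int h) (vec int a2) - cross (vec int g) (vec int a2).
    by rewrite /cross !mxE; ring.
  have [||f Hf fE] := lift (vec int h - vec int g).
  + by rewrite crB1; lia.
  + by rewrite crB2; lia.
  exists f => //; apply/mnmP => i; rewrite mnmDE.
  have /rowP/(_ i) := fE; rewrite !mxE !natz.
  by move: (f i) (g i) (h i) => p q r; lia.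
- by move=> f Hf /eqP; rewrite absz_eq0 => /eqP; exact: primitive_cross0.
- move=> f Hf /eqP; rewrite absz_eq0 => /eqP c0; apply: primitive_cross0 => //.
  by rewrite -oppr0 -c0 /cross; ring.
- move=> v v0.
  have [z [z1 /andP[z2 z3]]] := lattice_line_point v pr1 (mul1r 1) (mul1r _) d0.
  move: z1 z2 z3; rewrite !mul1r => z1 z2 z3.
  have [||h Hh hE] := lift z; [by rewrite z1 | exact: ltW |].
  exists h; rewrite hE z1; split=> //; rewrite gt0E ?z2 ?ltW //=.
  exact: abs_le.
- move=> v v0.
  have eE : -1 * cross (vec int a2) (vec int a1) = cross (vec int a1) (vec int a2).
    by rewrite /cross; ring.
  have [z [z1 /andP[z2 z3]]] := lattice_line_point v pr2 (mulrNN 1 1) eE d0.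
  have e1 : -1 * cross (vec int a2) z = cross z (vec int a2).
    by rewrite /cross; ring.
  have e2 : -1 * cross z (vec int a1) = cross (vec int a1) z.
    by rewrite /cross; ring.
  move: z1 z2 z3; rewrite e1 e2 => z1 z2 z3.
  have [||h Hh hE] := lift z; [exact: ltW | by rewrite z1 |].
  exists h; rewrite hE z1; split=> //; rewrite gt0E ?z2 ?ltW //=.
  exact: abs_le.
Qed.

Lemma exists_facet_coordinates (R : realType) (H : submonoid 2)
    (a1 a2 : 'X_{1..2}) :
  normal R H -> extremal_ray R H a1 -> extremal_ray R H a2 -> a1 <> a2 ->
  exists l1 l2 d, facet_coordinates R H a1 a2 l1 l2 d.
Proof.
move=> norH ext1 ext2 a12; have [_ pr1 _] := ext1; have [_ pr2 _] := ext2.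
have := primitive_cross_neq0 pr1 pr2 a12; rewrite neq_lt => /orP[d0|d0].
  have d0' : 0 < cross (vec int a2) (vec int a1).
    rewrite (_ : cross _ _ = - cross (vec int a1) (vec int a2)) ?oppr_gt0 //.
    by rewrite /cross; ring.
  have fc := facet_coordinates_sym (facet_coordinates_oriented norH ext2 ext1 d0').
  by do 3!eexists; exact: fc.
by do 3!eexists; exact: facet_coordinates_oriented norH ext1 ext2 d0.
Qed.

(** * Monomial submodules of the canonical module modulo x^c *)

Section MonomialModules.
Variables (K : fieldType) (n : nat) (H : submonoid n) (R : realType).
Implicit Types (g h c : 'X_{1..n}) (U : set 'X_{1..n}).

Notation A := (semigroup_ring K H).
Notation Om := (canonical_module K H R).

Definition ring_monomial h : A := insubd (0 : A) 'X_[h].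
Definition omega_monomial h : Om := insubd (0 : Om) (ring_monomial h : A^o).

Lemma poly_ring_monomial h :
  submonoid_set H h -> poly_of (ring_monomial h) = 'X_[h].
Proof.
move=> Hh; rewrite /ring_monomial; have := val_insubd (0 : A) 'X_[h] => ->.
rewrite ifT //; apply/asboolP => g.
by rewrite msuppX inE => /eqP->.
Qed.

Fact ring_const_subproof (a : K) : a%:MP_[n] \in semigroup_ring_pred H.
Proof.
apply/asboolP => h; rewrite msuppC; case: ifP => // _.
by rewrite inE => /eqP->; exact: submonoid0.
Qed.

(** The structure map of the K-algebra [A], through which lengths of [A]-modules are bounded by
    dimensions over [K]. *)
Definition ring_const (a : K) : A := SemigroupRing (ring_const_subproof a).

Fact ring_const_zmod_morphism : zmod_morphism ring_const.
Proof. by move=> a b; apply: val_inj; rewrite /= rmorphB. Qed.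

Fact ring_const_monoid_morphism : monoid_morphism ring_const.
Proof. by split=> [|a b]; apply: val_inj => //=; rewrite rmorphM. Qed.

HB.instance Definition _ :=
  GRing.isZmodMorphism.Build K A ring_const ring_const_zmod_morphism.
HB.instance Definition _ :=
  GRing.isMonoidMorphism.Build K A ring_const ring_const_monoid_morphism.

Hypothesis omega_sub : forall h, omega R H h -> submonoid_set H h.

Lemma poly_omega_monomial h :
  omega R H h -> poly_of (ring_elt_of (omega_monomial h)) = 'X_[h].
Proof.
move=> wh; rewrite /omega_monomial.
have -> := val_insubd (0 : Om) (ring_monomial h : A^o).
have E := poly_ring_monomial (omega_sub wh).
rewrite ifT //; apply/asboolP => g.
by rewrite E msuppX inE => /eqP->.
Qed.

Lemma canonical_msupp (w : Om) h :
  h \in msupp (poly_of (ring_elt_of w)) -> omega R H h.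
Proof. by have /asboolP := valP w; apply. Qed.

Lemma poly_of_inj (w w' : Om) :
  poly_of (ring_elt_of w) = poly_of (ring_elt_of w') -> w = w'.
Proof. by move=> ww'; apply: val_inj; apply: val_inj. Qed.

Lemma poly_ofZ (a : A) (w : Om) :
  poly_of (ring_elt_of (a *: w)) = poly_of a * poly_of (ring_elt_of w).
Proof. by []. Qed.

Lemma poly_ofD (w w' : Om) : poly_of (ring_elt_of (w + w')) =
  poly_of (ring_elt_of w) + poly_of (ring_elt_of w').
Proof. by []. Qed.

Lemma poly_of_sum (I : Type) (r : seq I) (F : I -> Om) :
  poly_of (ring_elt_of (\sum_(i <- r) F i)) =
  \sum_(i <- r) poly_of (ring_elt_of (F i)).
Proof.
by apply: (big_morph (fun w : Om => poly_of (ring_elt_of w))).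
Qed.

Lemma canonical_decomp (w : Om) :
  w = \sum_(h <- msupp (poly_of (ring_elt_of w)))
        ring_const (poly_of (ring_elt_of w))@_h *: omega_monomial h.
Proof.
apply: poly_of_inj; rewrite poly_of_sum [LHS]mpolyE.
apply: eq_big_seq => h /canonical_msupp wh.
rewrite -mul_mpolyC -(poly_omega_monomial wh).
by [].
Qed.

Lemma ring_monomial_scale g h : submonoid_set H g -> omega R H h ->
  ring_monomial g *: omega_monomial h = omega_monomial (h + g)%MM.
Proof.
move=> Hg wh; apply: poly_of_inj.
rewrite (poly_omega_monomial (omegaD wh Hg)) mpolyXD mulrC.
by rewrite -(poly_ring_monomial Hg) -(poly_omega_monomial wh).
Qed.

Variable c : 'X_{1..n}.
Notation E := (quotient_module (principal_pred K H R c)).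
Notation pi := (quotient_proj (principal_pred K H R c)).

Let cH : set 'X_{1..n} :=
  [set h | exists2 f, submonoid_set H f & h = (c + f)%MM].

Definition quotient_monomial h : E := pi (omega_monomial h).
Local Notation mon := quotient_monomial.

Lemma quotient_pi_eq0 (w : Om) :
  pi w = 0 <-> exists r : A, poly_of (ring_elt_of w) = 'X_[c] * poly_of r.
Proof.
have -> : 0 = pi 0.
  by apply: (addrI (pi 0)); rewrite -quotient_projD !addr0.
by rewrite quotient_projP subr0; split=> /asboolP.
Qed.

Lemma quotient_piZ a w : pi (a *: w) = a *: pi w.
Proof. by rewrite -quotient_projZ. Qed.

Lemma quotient_pi_sum (I : Type) (r : seq I) (F : I -> Om) :
  pi (\sum_(i <- r) F i) = \sum_(i <- r) pi (F i).
Proof.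
apply: (big_morph pi); first exact: quotient_projD.
by apply/quotient_pi_eq0; exists 0; rewrite mulr0.
Qed.

Lemma quotient_monomial_eq0 h : omega R H h -> cH h -> mon h = 0.
Proof.
move=> wh [f Hf hE]; apply/quotient_pi_eq0; exists (ring_monomial f).
by rewrite poly_omega_monomial // poly_ring_monomial // hE mpolyXD.
Qed.

Lemma quotient_decomp (x : E) : exists w : Om,
  x = \sum_(h <- msupp (poly_of (ring_elt_of w)))
        ring_const (poly_of (ring_elt_of w))@_h *: mon h.
Proof.
have <- := quotient_reprK x; set w := repr _; exists w.
rewrite [in LHS](canonical_decomp w) quotient_pi_sum.
by apply: eq_bigr => h _; rewrite quotient_piZ.
Qed.

Lemma quotient_monomialD g h : submonoid_set H g -> omega R H h ->
  mon (h + g)%MM = ring_monomial g *: mon h.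
Proof. by move=> Hg wh; rewrite -quotient_piZ ring_monomial_scale. Qed.

(** Admitting [cH], which contains all exponents of [x^c R], makes the support condition independent
    of the representative [w]. *)
Definition monomial_submodule U : set E :=
  [set x | exists2 w : Om, x = pi w &
     forall h, h \in msupp (poly_of (ring_elt_of w)) -> U h \/ cH h].

Definition up_closed U := forall g h, U h -> submonoid_set H g -> U (h + g)%MM.

Lemma cH_up_closed : up_closed cH.
Proof.
move=> g _ [f Hf ->] Hg; exists (f + g)%MM; first exact: submonoidD.
by rewrite addmA.
Qed.

Lemma ring_msupp (a : A) g : g \in msupp (poly_of a) -> submonoid_set H g.
Proof. by have /asboolP := valP a; apply. Qed.

Lemma monomial_submodule_submod U :
  up_closed U -> submod_closed (mem (monomial_submodule U)).
Proof.
move=> upU; split; rewrite ?inE.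
  by exists 0 => [|h]; rewrite ?msupp0 //; symmetry; apply/quotient_pi_eq0;
     exists 0; rewrite mulr0.
move=> a x y; rewrite !inE => -[w -> wU] [w' -> wU'].
exists (a *: w + w'); first by rewrite quotient_projD quotient_piZ.
move=> h; rewrite poly_ofD poly_ofZ.
move/msuppD_le; rewrite mem_cat => /orP[|/wU']//.
move/msuppM_le => /allpairsP[[g1 g2] /= [/ring_msupp Hg /wU g2U ->]].
rewrite addmC; case: g2U => [g2U|g2c]; [left | right]; first exact: upU.
exact: cH_up_closed.
Qed.

(** Any representative [w] differs from ['X_[h]] by a multiple of ['X_[c]], so [h] occurs either in
    [w] or in that multiple. This makes the chains of monomial submodules strict. *)
Lemma monomial_submodule_monomial U h :
  omega R H h -> monomial_submodule U (mon h) <-> U h \/ cH h.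
Proof.
move=> wh; split=> [[w /quotient_projP ww wU]|Uh]; last first.
  exists (omega_monomial h) => // g.
  by rewrite poly_omega_monomial // msuppX inE => /eqP->.
have [r rE] : exists r : A, 'X_[h] - poly_of (ring_elt_of w) = 'X_[c] * poly_of r.
  by have /asboolP[r] := ww; rewrite /= (poly_omega_monomial wh); exists r.
have [hw|hw] := boolP (h \in msupp (poly_of (ring_elt_of w))); first exact: wU.
have : h \in msupp ('X_[c] * poly_of r).
  by rewrite -rE mcoeff_msupp mcoeffB mcoeffX eqxx (memN_msupp_eq0 hw) subr0 oner_neq0.
move/msuppM_le => /allpairsP[[g1 g2] /= [+ /ring_msupp Hg ->]].
by rewrite msuppX inE => /eqP->; right; exists g2.
Qed.

Lemma monomial_submodule_setT U :
  (forall h, omega R H h -> U h) -> monomial_submodule U = setT.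
Proof.
move=> wU; apply/seteqP; split=> // x _.
have <- := quotient_reprK x; eexists; first reflexivity.
by move=> h /canonical_msupp /wU; left.
Qed.

Local Notation m := (graded_maximal_ideal K H).

Lemma graded_maximal_ideal_msupp (a : A) g : m a ->
  g \in msupp (poly_of a) -> submonoid_set H g /\ g <> 0%MM.
Proof.
pose P := [set a : A^o | forall g, g \in msupp (poly_of a) ->
  submonoid_set H g /\ g <> 0%MM].
move=> ma; suff : P a by apply.
move: ma; apply: submod_span_min.
  split; rewrite ?inE; first by move=> h; rewrite msupp0.
  move=> b x y; rewrite !inE => Px Py h.
  rewrite -[poly_of _]/(poly_of b * poly_of x + poly_of y).
  move/msuppD_le; rewrite mem_cat => /orP[|/Py]//.
  move/msuppM_le => /allpairsP[[g1 g2] /= [/ring_msupp Hg1 /Px[Hg2 g20] ->]].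
  split; first exact: submonoidD.
  by move=> /eqP; rewrite mnmD_eq0 => /andP[_ /eqP].
move=> p [h [Hh h0 pE]] k; rewrite pE msuppX inE => /eqP->.
by [].
Qed.

Lemma ideal_power_sub (U : nat -> set 'X_{1..n}) :
  (forall h, omega R H h -> U 0%N h) -> (forall i, up_closed (U i)) ->
  (forall i g h, U i h -> submonoid_set H g -> g <> 0%MM ->
     U i.+1 (h + g)%MM) ->
  forall i, ideal_power_mul m i `<=` monomial_submodule (U i).
Proof.
move=> U0 Uup US; elim=> [|i IH] /=.
  by rewrite (monomial_submodule_setT U0).
apply: submod_span_min; first exact: monomial_submodule_submod.
move=> _ [a [x [ma /IH[w -> wU] ->]]].
exists (a *: w); first by rewrite quotient_piZ.
move=> h; rewrite poly_ofZ.
move/msuppM_le => /allpairsP[[g1 g2] /= [/(graded_maximal_ideal_msupp ma)]].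
move=> [Hg1 g10] /wU[g2U|g2c] ->; rewrite addmC; [left | right].
  exact: US.
exact: cH_up_closed.
Qed.

Lemma ideal_power_submod i : submod_closed (mem (ideal_power_mul m i : set E)).
Proof.
case: i => [|i] /=; last exact: submod_span_submod.
by split=> [|a x y _ _]; rewrite inE.
Qed.

Lemma ideal_power_monomial g h i : submonoid_set H g -> g <> 0%MM ->
  omega R H h -> ideal_power_mul m i (mon (h + g *+ i)%MM).
Proof.
move=> Hg g0 wh; have Hgi j := submonoid_mulmn j Hg.
elim: i => [//|i IH] /=.
rewrite mulmS (addmC g) addmA quotient_monomialD //; last exact: omegaD.
rewrite -[_ *: _]scale1r; apply: submod_span_scale.
exists (ring_monomial g), (mon (h + g *+ i)%MM); split=> //.
have -> : ring_monomial g = (1 : A) *: (ring_monomial g : A^o) by rewrite scale1r.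
apply: submod_span_scale.
by exists g; rewrite poly_ring_monomial.
Qed.

Lemma quotient_generators (s : seq 'X_{1..n}) :
  (forall g, g \in s -> omega R H g) ->
  (forall h, omega R H h -> cH h \/
     exists g f, [/\ g \in s, submonoid_set H f & h = (g + f)%MM]) ->
  submod_span [set` [seq mon g | g <- s]] = setT.
Proof.
move=> sw gen; apply/seteqP; split=> // x _.
have [w ->] := quotient_decomp x.
pose I := msupp (poly_of (ring_elt_of w)).
rewrite -/I; have : forall h, h \in I -> omega R H h by move=> h /canonical_msupp.
elim: I => [|h I IH] wI.
  by rewrite big_nil -in_setE; case: (submod_span_submod [set` [seq mon g | g <- s]]).
have wh : omega R H h by apply: wI; rewrite inE eqxx.
rewrite big_cons -in_setE; apply: (proj2 (submod_span_submod _)); last first.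
  by rewrite in_setE; apply: IH => g gI; apply: wI; rewrite inE gI orbT.
rewrite in_setE; case: (gen h wh) => [/(quotient_monomial_eq0 wh)->|].
  by rewrite -in_setE; case: (submod_span_submod [set` [seq mon g | g <- s]]).
move=> [g [f [gs Hf ->]]]; rewrite quotient_monomialD //; last exact: sw.
by apply: submod_span_scale; apply/mapP; exists g.
Qed.

(** Supplies the spanning hypothesis of [submodule_chain_length_le] from a list of exponents. *)
Lemma quotient_const_span (N : set E) (s : seq 'X_{1..n}) :
  submod_closed (mem N) ->
  (forall h, omega R H h -> h \in s \/ N (mon h)) ->
  forall x, exists a : 'I_(size s) -> K,
    N (x - \sum_j ring_const (a j) *: mon (nth 0%MM s j)).
Proof.
move=> subN sN x; have [w ->] := quotient_decomp x.
pose I := msupp (poly_of (ring_elt_of w)).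
rewrite -/I; have : forall h, h \in I -> omega R H h by move=> h /canonical_msupp.
have [+ ND] := subN; rewrite in_setE => N0.
have zero j : ring_const 0 *: mon (nth 0%MM s j) = 0.
  have -> : ring_const 0 = 0 by exact: raddf0.
  by rewrite scale0r.
elim: I => [|h I IH] wI.
  exists (fun=> 0); rewrite big_nil big1 => [|j _]; last exact: zero.
  by rewrite subr0.
have wh : omega R H h by apply: wI; rewrite inE eqxx.
have [|a aN] := IH; first by move=> g gI; apply: wI; rewrite inE gI orbT.
set k := ((poly_of (ring_elt_of w))@_h).
have [b bN] : exists b : 'I_(size s) -> K,
    N (mon h - \sum_j ring_const (b j) *: mon (nth 0%MM s j)).
  case: (sN h wh) => [hs|hN]; last first.
    exists (fun=> 0); rewrite big1 => [|j _]; last exact: zero.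
    by rewrite subr0.
  have hi : (index h s < size s)%N by rewrite index_mem.
  exists (fun j => (j == Ordinal hi)%:R); rewrite (bigD1 (Ordinal hi)) //= eqxx.
  rewrite big1 => [|j /negPf->]; last exact: zero.
  by rewrite rmorph1 scale1r nth_index // addr0 subrr.
exists (fun j => k * b j + a j); rewrite big_cons -in_setE.
have -> : \sum_j ring_const (k * b j + a j) *: mon (nth 0%MM s j) =
    ring_const k *: (\sum_j ring_const (b j) *: mon (nth 0%MM s j)) +
    \sum_j ring_const (a j) *: mon (nth 0%MM s j).
  rewrite scaler_sumr -big_split; apply: eq_bigr => j _.
  rewrite /= scalerA -scalerDl; congr (_ *: _).
  by apply: val_inj; rewrite /= rmorphD rmorphM.
rewrite opprD addrACA -scalerBr.
by apply: ND; rewrite in_setE.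
Qed.

(* The monomials of T are adjoined to U one by one in decreasing monomial
   order, which keeps the exponent set closed under H. *)
Lemma monomial_chain (N : set E) U (T : seq 'X_{1..n}) :
  submod_closed (mem N) -> up_closed U -> N `<=` monomial_submodule U ->
  uniq T -> (0 < size T)%N ->
  (forall h, h \in T -> [/\ omega R H h, ~ U h & ~ cH h]) ->
  submodule_chain N (size T).
Proof.
move=> subN upU NU uT T0 TU.
pose t := sort <=%O T; pose l := size T.
have tP h : h \in t -> [/\ omega R H h, ~ U h & ~ cH h].
  by rewrite mem_sort; exact: TU.
have st : size t = l by rewrite size_sort.
(* [tn 1] is the largest exponent and [tn l] the smallest; [tn 0] falls on the default value, hence
   the guard [0 < i] in [V]. *)
pose tn i := nth 0%MM t (l - i).
have tlt i j : (i < j <= l)%N -> (0 < i)%N -> (tn j < tn i)%O.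
  move=> /andP[ij jl] i0; rewrite /tn lt_sorted_ltn_nth ?inE ?st; try lia.
  by rewrite sort_lt_sorted.
have tnP i : (0 < i <= l)%N -> [/\ omega R H (tn i), ~ U (tn i) & ~ cH (tn i)].
  by move=> il; apply: tP; apply: mem_nth; rewrite st; lia.
pose V i : set 'X_{1..n} := U `|` [set h | (0 < i)%N /\ (tn i <= h)%O].
have Vup i : up_closed (V i).
  move=> g h [Uh|[i0 th]] Hg; [left; exact: upU | right; split=> //].
  exact: le_trans th (lemc_addr _ _).
have Vin i : (0 < i <= l)%N -> monomial_submodule (V i) (mon (tn i)).
  move=> il; have [wi _ _] := tnP _ il.
  by apply/(monomial_submodule_monomial _ wi); left; right; split; [lia|].
have Vout i : (i < l)%N -> ~ monomial_submodule (V i) (mon (tn i.+1)).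
  move=> il; have [//|wi Ui ci] := tnP i.+1 _.
  move/(monomial_submodule_monomial _ wi) => -[[//|[i0 ti]]|//].
  have /tlt/(_ i0) : (i < i.+1 <= l)%N by rewrite ltnSn.
  by rewrite ltNge ti.
have Vsub i : monomial_submodule U `<=` monomial_submodule (V i).
  by move=> x [w xw wU]; exists w => // h /wU[|]; [left; left | right].
have VV i : (i < l)%N -> monomial_submodule (V i) `<=` monomial_submodule (V i.+1).
  move=> il x [w xw wU]; exists w => // h /wU[[|[i0 ih]]|]; last by right.
    by left; left.
  left; right; split=> //; apply: le_trans ih; apply: ltW.
  by apply: tlt => //; rewrite ltnSn.
(* The ends are forced to be [N] and the whole module; as [N] lies below every [V i], strictness is
   preserved. *)
exists (fun i => if i == l then setT else if i == 0%N then N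
  else monomial_submodule (V i)); split.
- by rewrite -[0%N == l]eq_sym gtn_eqF.
- by rewrite eqxx.
- move=> i _; case: eqP => _; first by split=> [|a x y _ _]; rewrite inE.
  by case: eqP => _ //; apply: monomial_submodule_submod.
move=> i il; rewrite (ltn_eqF il) /=.
have sub : (if i == 0%N then N else monomial_submodule (V i)) `<=`
    monomial_submodule (V i).
  by case: eqP => _ //; apply: subset_trans NU (Vsub i).
split.
  by move=> x /sub Vx; case: eqP => // _; apply: VV.
move=> /(_ (mon (tn i.+1))) H1; apply: (Vout i il); apply: sub; apply: H1.
by case: eqP => // /eqP il'; apply: Vin; lia.
Qed.

End MonomialModules.

(** * Multiplicity and number of generators *)

Section Strips.
Variables (R : realType) (H : submonoid 2) (a1 a2 : 'X_{1..2}).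
Variables (l1 l2 : 'X_{1..2} -> nat) (d : nat).
Hypothesis fc : facet_coordinates R H a1 a2 l1 l2 d.
Implicit Types (f g h : 'X_{1..2}).

Lemma facet_omega_sub h : omega R H h -> submonoid_set H h.
Proof. by case/(facet_omega fc). Qed.

Lemma facet0 : l1 0%MM = 0%N /\ l2 0%MM = 0%N.
Proof.
have := facetD fc (submonoid0 H) (submonoid0 H); rewrite addm0.
by lia.
Qed.

Lemma facet_ray1_mul k : [/\ submonoid_set H (a1 *+ k)%MM,
  l1 (a1 *+ k)%MM = 0%N & l2 (a1 *+ k)%MM = (k * d)%N].
Proof.
have [Ha l1a l2a] := facet_ray1 fc; have [z1 z2] := facet0.
elim: k => [|k [Hk l1k l2k]].
  by rewrite mulm0n z1 z2; split=> //; exact: submonoid0.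
have [e1 e2] := facetD fc Ha Hk.
by rewrite mulmS e1 e2 l1a l2a l1k l2k mulSn; split=> //; exact: submonoidD.
Qed.

Lemma facet_ray1D h k : submonoid_set H h ->
  [/\ submonoid_set H (h + a1 *+ k)%MM, l1 (h + a1 *+ k)%MM = l1 h
    & l2 (h + a1 *+ k)%MM = (l2 h + k * d)%N].
Proof.
have [Hk e1 e2] := facet_ray1_mul k.
move=> Hh; have [-> ->] := facetD fc Hh Hk.
by rewrite e1 e2 addn0; split=> //; exact: submonoidD.
Qed.

Lemma facet_ray1_neq0 : a1 <> 0%MM.
Proof.
move=> a0; have [_ _] := facet_ray1 fc; rewrite a0 (proj2 facet0).
by have := facet_d_gt0 fc; lia.
Qed.

Lemma facet_weight_ge g :
  submonoid_set H g -> g <> 0%MM -> (d <= l2 g + d * l1 g)%N.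
Proof.
move=> Hg g0; have [l1g|] := posnP (l1 g); last by nia.
have [k gE] := facet_line1 fc Hg l1g.
have [_ _ l2g] := facet_ray1_mul k; rewrite gE l2g.
by case: k gE {l2g} => [|k gE]; [rewrite mulm0n | nia].
Qed.

(** Two points of [H] on one line differ by a multiple of [a1], which shifts [l2] by a multiple of
    [d]; the bound [l2 p <= d] leaves no room for a point of [omega] before [p]. *)
Lemma facet_first_point v : (0 < v)%N -> exists p, [/\ omega R H p,
  l1 p = v, (l2 p <= d)%N &
  forall h, omega R H h -> l1 h = v -> exists k, h = (p + a1 *+ k)%MM].
Proof.
move=> v0; have [p [Hp l1p /andP[p0 pd]]] := facet_point1 fc v0.
exists p; split=> //; first by apply/(facet_omega fc); rewrite l1p.
move=> h /(facet_omega fc)[Hh _ h0] l1h; have [ph|hp] := leqP (l2 p) (l2 h).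
  have [|f Hf hE] := facet_le fc Hp Hh _ ph; first by rewrite l1p l1h.
  have l1f : l1 f = 0%N by have := facetD fc Hp Hf; rewrite -hE; lia.
  by have [k fE] := facet_line1 fc Hf l1f; exists k; rewrite hE fE.
have [|f Hf pE] := facet_le fc Hh Hp _ (ltnW hp); first by rewrite l1p l1h.
have l1f : l1 f = 0%N by have := facetD fc Hh Hf; rewrite -pE; lia.
have [k fE] := facet_line1 fc Hf l1f.
have [_ _ e] := facet_ray1D k Hh; move: e; rewrite -fE -pE.
by case: k {fE} => [|k]; nia.
Qed.

Lemma facet_first_points : exists p : nat -> 'X_{1..2}, forall v, (0 < v)%N ->
  [/\ omega R H (p v), l1 (p v) = v, (l2 (p v) <= d)%N &
  forall h, omega R H h -> l1 h = v -> exists k, h = (p v + a1 *+ k)%MM].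
Proof.
have /choice[p pP] : forall v, exists p, (0 < v)%N -> [/\ omega R H p,
    l1 p = v, (l2 p <= d)%N &
    forall h, omega R H h -> l1 h = v -> exists k, h = (p + a1 *+ k)%MM].
  case=> [|v]; first by exists 0%MM.
  by have [//|p pP] := @facet_first_point v.+1; exists p.
by exists p.
Qed.

(** The offset [k0] is 0 when all early points must be listed, and positive when the strips along
    the two rays must be disjoint. *)
Definition strip (p : nat -> 'X_{1..2}) L k0 N :=
  [seq (p v + a1 *+ k)%MM | v <- iota 1 L, k <- iota k0 N].

Lemma size_strip p L k0 N : size (strip p L k0 N) = (L * N)%N.
Proof. by rewrite size_allpairs !size_iota. Qed.

Lemma mem_stripP p L k0 N h : reflect
  (exists v k, [/\ (0 < v <= L)%N, (k0 <= k < k0 + N)%N & h = (p v + a1 *+ k)%MM])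
  (h \in strip p L k0 N).
Proof.
apply: (iffP allpairsP) => [[[v k] /= []]|[v [k [vL kN ->]]]].
  by rewrite !mem_iota => ? ? ->; exists v, k; split=> //; lia.
by exists (v, k); rewrite /= !mem_iota; split=> //; lia.
Qed.

Lemma strip_uniq p L k0 N :
  (forall v, (0 < v)%N -> submonoid_set H (p v) /\ l1 (p v) = v) ->
  uniq (strip p L k0 N).
Proof.
move=> pP; apply: allpairs_uniq; rewrite ?iota_uniq //.
move=> _ _ /allpairsP[[v k] /= [vL kN ->]] /allpairsP[[v' k'] /= [vL' kN' ->]] /= e.
have [Hv l1v] : submonoid_set H (p v) /\ l1 (p v) = v.
  by apply: pP; move: vL; rewrite mem_iota; lia.
have [Hv' l1v'] : submonoid_set H (p v') /\ l1 (p v') = v'.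
  by apply: pP; move: vL'; rewrite mem_iota; lia.
have [_ e1 e2] := facet_ray1D k Hv; have [_ e1' e2'] := facet_ray1D k' Hv'.
have vv : v = v' by rewrite -l1v -l1v' -e1 -e1' e.
move: e2; rewrite e e2' vv => /addnI/eqP.
by rewrite eqn_pmul2r ?(facet_d_gt0 fc) // => /eqP->.
Qed.

End Strips.

Section UlrichStrip.
Variables (R : realType) (K : fieldType) (H : submonoid 2) (a1 a2 c : 'X_{1..2}).
Variables (l1 l2 : 'X_{1..2} -> nat) (d : nat).
Hypothesis fc : facet_coordinates R H a1 a2 l1 l2 d.
Hypothesis wc : omega R H c.
Implicit Types (f g h : 'X_{1..2}).

Let fc' := facet_coordinates_sym fc.
Let wH := facet_omega_sub fc.
Let Hc : submonoid_set H c := wH wc.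
Local Notation E := (quotient_module (principal_pred K H R c)).
Local Notation m := (graded_maximal_ideal K H).
Local Notation mon := (@quotient_monomial K 2 H R c).

Lemma facet_above h : omega R H h -> (l1 c <= l1 h)%N -> (l2 c <= l2 h)%N ->
  exists2 f, submonoid_set H f & h = (c + f)%MM.
Proof. by move=> /wH Hh; exact: (facet_le fc). Qed.

Lemma facet_above_ge h : (exists2 f, submonoid_set H f & h = (c + f)%MM) ->
  (l1 c <= l1 h)%N /\ (l2 c <= l2 h)%N.
Proof.
by move=> [f Hf ->]; have [-> ->] := facetD fc Hc Hf; rewrite !leq_addr.
Qed.

(* Every nonzero element of H has both weights [l2 + d * l1] and [l1 + d * l2]
   at least d, so m^i lives in weights at least i * d. *)
Let weight_set i : set 'X_{1..2} := [set h | [/\ submonoid_set H h,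
  (i * d <= l2 h + d * l1 h)%N & (i * d <= l1 h + d * l2 h)%N]].

Lemma weight_set_up i : up_closed H (weight_set i).
Proof.
move=> g h [Hg g1 g2] Hh; have [e1 e2] := facetD fc Hg Hh.
by rewrite /weight_set /= e1 e2; split; [exact: submonoidD | nia | nia].
Qed.

Lemma ideal_power_weight i :
  (ideal_power_mul m i : set E) `<=` monomial_submodule (weight_set i).
Proof.
apply: (ideal_power_sub _ weight_set_up) => [h /wH Hh|j g h [Hh h1 h2] Hg g0].
  by split; rewrite ?mul0n.
have := facet_weight_ge fc Hg g0; have := facet_weight_ge fc' Hg g0.
have [e1 e2] := facetD fc Hh Hg.
by rewrite /weight_set /= e1 e2; split; [exact: submonoidD | nia | nia].
Qed.

Let L1 := (l1 c).-1.
Let L2 := (l2 c).-1.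

(** The first [n.+1] points of each line span over [K]: later ones are shifted by [n.+1] copies of a
    ray vector and lie in [m^{n+1}], and points above [c] vanish. The two strips may overlap, which
    is harmless for an upper bound. *)
Lemma colength_ideal_power_le n l : colength (ideal_power_mul m n.+1 : set E) l ->
  (l <= (L1 + L2) * n.+1)%N.
Proof.
have [p pP] := facet_first_points fc; have [q qP] := facet_first_points fc'.
move=> [chain _]; pose s := strip a1 p L1 0 n.+1 ++ strip a2 q L2 0 n.+1.
have -> : ((L1 + L2) * n.+1 = size s)%N by rewrite size_cat !size_strip mulnDl.
set N := ideal_power_mul m n.+1 in chain.
have subN : submod_closed (mem N) := ideal_power_submod K H R c n.+1.
have spanN : forall h, omega R H h -> h \in s \/ N (mon h).
  have aux a (Ha : submonoid_set H a) (a0 : a <> 0%MM) r L v k :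
      omega R H (r v) -> (0 < v <= L)%N ->
      (r v + a *+ k)%MM \in strip a r L 0 n.+1 \/ N (mon (r v + a *+ k)%MM).
    move=> wr vL; have [kn|nk] := ltnP k n.+1.
      by left; apply/mem_stripP; exists v, k.
    right; have -> : (r v + a *+ k)%MM =
        (r v + a *+ (k - n.+1) + a *+ n.+1)%MM.
      by apply/mnmP => j; rewrite !mnmDE !mulmnE -addnA -mulnDr subnK.
    apply: (ideal_power_monomial K wH c n.+1 Ha a0).
    apply: omegaD => //.
    exact: submonoid_mulmn.
  move=> h wh; have [_ h1 h2] := proj1 (facet_omega fc h) wh.
  have [Ha1 _ _] := facet_ray1 fc; have [Ha2 _ _] := facet_ray2 fc.
  have [hc1|ch1] := ltnP (l1 h) (l1 c).
    have [wp _ _ /(_ h wh erefl)[k ->]] := pP _ h1.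
    have [|hs|hN] := aux a1 Ha1 (facet_ray1_neq0 fc) p L1 (l1 h) k wp.
    - by rewrite /L1; lia.
    - by left; rewrite mem_cat hs.
    - by right.
  have [hc2|ch2] := ltnP (l2 h) (l2 c).
    have [wq _ _ /(_ h wh erefl)[k ->]] := qP _ h2.
    have [|hs|hN] := aux a2 Ha2 (facet_ray1_neq0 fc') q L2 (l2 h) k wq.
    - by rewrite /L2; lia.
    - by left; rewrite mem_cat hs orbT.
    - by right.
  right; rewrite (quotient_monomial_eq0 K wH) //; last exact: facet_above.
  by rewrite -in_setE; case: subN.
have spn := quotient_const_span wH subN spanN.
exact: (@submodule_chain_length_le _ _ _ (ring_const H : {rmorphism K -> _})
  N _ l _ spn chain).
Qed.

(** Starting at position [l2 c] or [l1 c] keeps the two strips apart; taking [l1 c + l2 c] fewer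
    than [n] points per line keeps one of the weights too small for [m^{n+1}]. *)
Lemma colength_ideal_power_ge n l :
  (0 < L1 + L2)%N -> (l1 c + l2 c < n)%N ->
  colength (ideal_power_mul m n.+1 : set E) l ->
  ((L1 + L2) * (n - (l1 c + l2 c)) <= l)%N.
Proof.
move=> L0 cn [_ maxl].
have [p pP] := facet_first_points fc; have [q qP] := facet_first_points fc'.
set N := (n - (l1 c + l2 c))%N.
pose T := strip a1 p L1 (l2 c) N ++ strip a2 q L2 (l1 c) N.
have sT : size T = ((L1 + L2) * N)%N by rewrite size_cat !size_strip mulnDl.
rewrite -sT; apply: maxl.
have d0 := facet_d_gt0 fc.
have T1 h : h \in strip a1 p L1 (l2 c) N ->
    [/\ omega R H h, ~ weight_set n.+1 h, (l1 h < l1 c)%N & (l2 c <= l2 h)%N].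
  case/mem_stripP=> v [k [vL kN ->]].
  have [|wp l1p l2p _] := pP v; first by lia.
  have [Hk e1 e2] := facet_ray1D fc k (wH wp).
  have [_ _ l2p0] := proj1 (facet_omega fc _) wp.
  have vc : (v < l1 c)%N by move: vL; rewrite /L1; lia.
  split.
  - by apply/(facet_omega fc); rewrite e1 e2 l1p; split=> //; lia.
  - case=> _ + _; rewrite e1 e2 l1p.
    (* [l2 (p v) <= d] bounds the first weight by [d * (k + v + 1)], hence by [d * n]. *)
    have : (k + v + 1 <= n)%N by move: kN cn; rewrite /N; lia.
    by nia.
  - by rewrite e1 l1p.
  - by rewrite e2; nia.
have T2 h : h \in strip a2 q L2 (l1 c) N ->
    [/\ omega R H h, ~ weight_set n.+1 h, (l2 h < l2 c)%N & (l1 c <= l1 h)%N].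
  case/mem_stripP=> v [k [vL kN ->]].
  have [|wp l1p l2p _] := qP v; first by lia.
  have [Hk e1 e2] := facet_ray1D fc' k (wH wp).
  have [_ l2p0 _] := proj1 (facet_omega fc _) wp.
  have vc : (v < l2 c)%N by move: vL; rewrite /L2; lia.
  split.
  - by apply/(facet_omega fc); rewrite e1 e2 l1p; split=> //; lia.
  - case=> _ _; rewrite e1 e2 l1p.
    have : (k + v + 1 <= n)%N by move: kN cn; rewrite /N; lia.
    by nia.
  - by rewrite e1 l1p.
  - by rewrite e2; nia.
apply: (monomial_chain wH) (ideal_power_submod K H R c n.+1) (@weight_set_up n.+1)
  (@ideal_power_weight n.+1) _ _ _.
- rewrite cat_uniq (strip_uniq fc) ?(strip_uniq fc') ?andbT.
  + apply/hasPn => h /T2[_ _ h2 _]; apply/negP => /T1[_ _ _].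
    by rewrite leqNgt h2.
  + by move=> v /qP[/wH].
  + by move=> v /pP[/wH].
- by rewrite sT muln_gt0 L0 /N subn_gt0.
move=> h; rewrite mem_cat => /orP[/T1|/T2] [wh Uh h1 h2]; split=> //.
  by move=> /facet_above_ge; lia.
by move=> /facet_above_ge; lia.
Qed.

(** The slope [L1 + L2] is nonzero, so the polynomial has degree exactly 1, and the factorial in the
    definition is 1. *)
Lemma multiplicity_quotient e :
  (0 < L1 + L2)%N -> multiplicity m E e -> e = (L1 + L2)%N.
Proof.
move=> L0 [k [p [_ sp [n0 pP] eE]]].
(* [M] absorbs both errors: [L1 + L2] above and [(L1 + L2) * (l1 c + l2 c)] below. *)
pose M := ((L1 + L2) * (l1 c + l2 c).+1)%N.
have [n|j pE] := @bounded_natvalued_poly_affine p (L1 + L2) (n0 + (l1 c + l2 c).+1) M.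
  move=> nn; have [|l [col pl]] := pP n; first by lia.
  have cn : (l1 c + l2 c < n)%N by lia.
  have hi := colength_ideal_power_le col.
  have lo := colength_ideal_power_ge L0 cn col.
  have split_n : ((L1 + L2) * n =
      (L1 + L2) * (n - (l1 c + l2 c)) + (L1 + L2) * (l1 c + l2 c))%N.
    by rewrite -mulnDr subnK // ltnW.
  exists l; split=> //; move: hi; rewrite /M !mulnS.
  by clear -lo split_n; lia.
have L0' : (L1 + L2)%:R != 0 :> rat by rewrite pnatr_eq0 -lt0n.
have sp2 : size p = 2.
  by rewrite pE size_polyDl ?size_scale ?size_polyX // ltnS size_polyC_leq1.
move: eE; rewrite lead_coefE sp2 /= pE coefD coefZ coefX coefC /= mulr1 addr0.
have -> : k = 1%N by move: sp; rewrite sp2 => -[].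
by rewrite mul1r => /eqP; rewrite eqr_nat => /eqP.
Qed.

(* The first lattice points on the L1 + L2 lines parallel to a facet and
   strictly below c generate omega / x^c; if one of them is decomposable it can
   be dropped, and the number of generators falls below the multiplicity. *)
Lemma not_ulrich_of_decomposable g f :
  omega R H g -> submonoid_set H f -> f <> 0%MM ->
  (l2 (g + f)%MM < l2 c)%N -> (l1 (g + f)%MM <= d)%N -> ~ ulrich m E.
Proof.
move=> wg Hf f0 qc qd; set x := (g + f)%MM in qc qd.
have wx : omega R H x by apply: omegaD.
have [_ x1 x2] := proj1 (facet_omega fc x) wx.
have [_ g1 g2] := proj1 (facet_omega fc g) wg.
have [ge1 ge2] := facetD fc (wH wg) Hf.
have d0 := facet_d_gt0 fc.
(* A nonzero multiple of [a2] added to [g] would push [l1] beyond [d]; so [g] lies on a strictly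
   lower line. *)
have gx : (l2 g < l2 x)%N.
  rewrite /x ge2 -[X in (X < _)%N]addn0 ltn_add2l lt0n; apply/eqP => l2f.
  have [k fE] := facet_line2 fc Hf l2f.
  have [_ _ e] := facet_ray1D fc' k (wH wg).
  move: qd; rewrite /x fE e; case: k fE {e} => [|k _]; first by rewrite mulm0n.
  by nia.
(* [x] is not above [c], so its class is nonzero and the quotient is not the zero module. *)
case=> [triv|[_ [e [[_ gen] mult]]]].
  have : monomial_submodule set0 (mon x).
    have up0 : up_closed H set0 by [].
    rewrite (triv (mon x)) -in_setE.
    by have [] := @monomial_submodule_submod K 2 H R c _ up0.
  by case/(monomial_submodule_monomial K wH c set0 wx) => // /facet_above_ge; lia.
have L2_gt0 : (0 < L2)%N by rewrite /L2; lia.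
have eE : e = (L1 + L2)%N.
  by apply: multiplicity_quotient => //; rewrite addn_gt0 L2_gt0 orbT.
have [p pP] := facet_first_points fc; have [q qP] := facet_first_points fc'.
pose s := [seq p v | v <- iota 1 L1] ++ [seq q w | w <- rem (l2 x) (iota 1 L2)].
have xL : l2 x \in iota 1 L2 by rewrite mem_iota /L2; lia.
have pgen h : omega R H h -> (l1 h < l1 c)%N ->
    exists a b, [/\ a \in s, submonoid_set H b & h = (a + b)%MM].
  move=> wh hc; have [_ h1 h2] := proj1 (facet_omega fc h) wh.
  have [_ _ _ /(_ h wh erefl)[k hE]] := pP _ h1.
  exists (p (l1 h)), (a1 *+ k)%MM; split=> //.
    rewrite mem_cat; apply/orP; left; apply/mapP; exists (l1 h) => //.
    by rewrite mem_iota /L1; lia.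
  by have [] := facet_ray1_mul fc k.
have qgen h : omega R H h -> (l2 h < l2 c)%N -> l2 h != l2 x ->
    exists a b, [/\ a \in s, submonoid_set H b & h = (a + b)%MM].
  move=> wh hc hx; have [_ h1 h2] := proj1 (facet_omega fc h) wh.
  have [_ _ _ /(_ h wh erefl)[k hE]] := qP _ h2.
  exists (q (l2 h)), (a2 *+ k)%MM; split=> //.
    rewrite mem_cat; apply/orP; right; apply/mapP; exists (l2 h) => //.
    rewrite mem_rem_uniq ?iota_uniq // inE hx mem_iota /L2; lia.
  by have [] := facet_ray1_mul fc' k.
have := gen [seq mon h | h <- s]; rewrite (quotient_generators K wH).
- move=> /(_ erefl); rewrite size_map size_cat !size_map size_rem // !size_iota eE.
  by lia.
- move=> h; rewrite mem_cat => /orP[] /mapP[v vL ->].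
    by have [|] := pP v; first by move: vL; rewrite mem_iota; lia.
  by have [|] := qP v; first by move: vL => /mem_rem; rewrite mem_iota; lia.
move=> h wh; have [hc1|ch1] := ltnP (l1 h) (l1 c); first by right; exact: pgen.
have [hc2|ch2] := ltnP (l2 h) (l2 c); last by left; exact: facet_above.
right; have [hx|] := eqVneq (l2 h) (l2 x); last exact: qgen.
have [wq l2q l1q qx] := qP _ x2.
have [k xE] := qx x wx erefl; have [k' hE] := qx h wh hx.
have [_ q1 _] := proj1 (facet_omega fc _) wq.
have [_ _ l1x] := facet_ray1D fc' k (wH wq); rewrite -xE in l1x.
(* As [l1 x <= d], [x] is the first point of its line, the generator that [s] omits; it is recovered
   from [g]. *)
have k0 : k = 0%N by move: l1x qd q1; case: (k) => // j; nia.
have [||a [b [as_ Hb gE]]] := qgen g wg.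
- exact: ltn_trans gx qc.
- by rewrite neq_ltn gx.
have [Hk' _ _] := facet_ray1_mul fc' k'.
exists a, (b + f + a2 *+ k')%MM; split=> //.
  by apply: submonoidD => //; exact: submonoidD.
have -> : h = (x + a2 *+ k')%MM by rewrite xE k0 mulm0n addm0.
by rewrite /x gE !addmA.
Qed.

End UlrichStrip.

(** * The fundamental parallelepiped and the bottom element *)

Lemma fundamental_parallelepiped_not_above (R : realType) (H : submonoid 2)
    (a1 a2 x f : 'X_{1..2}) :
  extremal_ray R H a1 -> extremal_ray R H a2 -> a1 <> a2 ->
  fundamental_parallelepiped R a1 a2 (vec R x) ->
  submonoid_set H f -> x <> (a2 + f)%MM.
Proof.
move=> [Ha1 pr1 [_ _ ext1]] [Ha2 pr2 _] a12 [t1 [t2 [/andP[t10 _] /andP[_ t21] xE]]].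
move=> Hf xf; move: xE; rewrite xf vecD => fE.
have t2' : 0 < 1 - t2 by rewrite subr_gt0.
have C2 : semigroup_cone R H ((1 - t2) *: vec R a2).
  by apply: semigroup_cone_scale (ltW t2') _; exact: semigroup_cone_vec.
(* Cancelling [t2 *: a2] puts [f + (1 - t2) a2] on the ray of [a1]; extremality then puts a positive
   multiple of [a2] there, though the rays are not parallel. *)
have [_ [t _ tE]] : ray (vec R a1) (vec R f) /\
    ray (vec R a1) ((1 - t2) *: vec R a2).
  apply: ext1 C2 _; first exact: semigroup_cone_vec.
  exists t1 => //; rewrite scalerBl scale1r addrA (addrC (vec R f)) fE.
  by rewrite addrK.
have : (1 - t2) * cross (vec R a1) (vec R a2) = 0.
  transitivity (cross (vec R a1) ((1 - t2) *: vec R a2)).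
    by rewrite /cross !mxE; ring.
  by rewrite tE /cross !mxE; ring.
move/eqP; rewrite mulf_eq0 gt_eqF //= (cross_vec R) intr_eq0.
by rewrite (negPf (primitive_cross_neq0 pr1 pr2 a12)).
Qed.

Lemma fundamental_parallelepiped_sym (R : realType) (a1 a2 : 'X_{1..2}) :
  fundamental_parallelepiped R a1 a2 `<=` fundamental_parallelepiped R a2 a1.
Proof.
by move=> x [t1 [t2 [? ? xE]]]; exists t2, t1; rewrite addrC.
Qed.

Lemma not_ulrich_below_bottom (R : realType) (K : fieldType) (H : submonoid 2)
    (a1 a2 b c : 'X_{1..2}) (l1 l2 : 'X_{1..2} -> nat) (d : nat) :
  facet_coordinates R H a1 a2 l1 l2 d ->
  extremal_ray R H a1 -> extremal_ray R H a2 -> a1 <> a2 ->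
  fundamental_parallelepiped R a1 a2 (vec R (b *+ 2)%MM) ->
  bottom_element R H b -> c <> b -> (l1 c < l1 b)%N ->
  ~ ulrich_element K H R c.
Proof.
move=> fc ext1 ext2 a12 par [wb bmin] cb cl [wc ulr].
have [Hb b1 b2] := proj1 (facet_omega fc b) wb.
have [Hc c1 c2] := proj1 (facet_omega fc c) wc.
have Hbb := submonoidD Hb Hb; have [bb1 bb2] := facetD fc Hb Hb.
have not_le : ~ (c <= b)%MM.
  move=> /mnm_lepP le; apply: cb; apply/mnmP => i; apply/eqP.
  by rewrite eqn_leq le; have /mnm_lepP := bmin _ wc; apply.
have bc : (l2 b < l2 c)%N.
  rewrite ltnNge; apply/negP => le; apply: not_le.
  by have [f _ ->] := facet_le fc Hc Hb (ltnW cl) le; exact: lem_addr.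
have bbd : (l1 (b + b)%MM < d)%N.
  rewrite ltnNge; apply/negP => le; have [Ha2 la2 la2'] := facet_ray2 fc.
  have [||f Hf bbE] := facet_le fc Ha2 Hbb; rewrite ?la2 ?la2' //.
  have := fundamental_parallelepiped_not_above ext1 ext2 a12 par Hf.
  by apply; rewrite -bbE.
have b0 : b <> 0%MM by move=> b0; move: b1; rewrite b0 (proj1 (facet0 fc)).
have [bbc|cbb] := ltnP (l2 (b + b)%MM) (l2 c).
  exact: (not_ulrich_of_decomposable fc wc wb Hb b0 bbc (ltnW bbd) ulr).
have [||f Hf bbE] := facet_le fc Hc Hbb; [by lia | by [] |].
have [cf1 cf2] := facetD fc Hc Hf.
have f1 : (0 < l1 f)%N by move: cf1; rewrite -bbE bb1; lia.
(* If [l2 f = 0], then [f] is a multiple of [a2] with [l1 f > 0], so [l1 f >= d], against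
   [l1 (b + b) < d]. *)
have [f2|f2] := posnP (l2 f).
  have [k fE] := facet_line2 fc Hf f2.
  have [_ _ lk] := facet_ray1_mul (facet_coordinates_sym fc) k.
  by move: bbd f1; rewrite bbE cf1 fE lk; case: (k) => // j; nia.
apply: not_le; apply/mnm_lepP => i.
have wf : omega R H f by apply/(facet_omega fc).
have /mnm_lepP/(_ i) := bmin _ wf.
have /mnmP/(_ i) := bbE; rewrite !mnmDE.
by move: (b i) (c i) (f i); lia.
Qed.

Theorem proposition5p5 (R : realType) (K : fieldType) (H : submonoid 2)
    (a1 a2 b b' : 'X_{1..2}) (B : set 'X_{1..2}) :
  normal_affine_semigroup2 R H ->
  extremal_ray R H a1 -> extremal_ray R H a2 -> a1 <> a2 ->
  bottom_element R H b ->
  minimal_generating_set H B ->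
  fundamental_parallelepiped R a1 a2 (vec R (b *+ 2)%MM) ->
  B b' ->
  ulrich_element K H R b' ->
  b' = b.
Proof.
move=> [_ _ norH] ext1 ext2 a12 bot minB par Bb' ulr; apply: contrapT => b'b.
have [l1 [l2 [d fc]]] := exists_facet_coordinates norH ext1 ext2 a12.
have [Hb b1 b2] := proj1 (facet_omega fc b) (proj1 bot).
have [Hb' _ _] := proj1 (facet_omega fc b') (proj1 ulr).
have [lt1|le1] := ltnP (l1 b') (l1 b).
  exact: (not_ulrich_below_bottom fc ext1 ext2 a12 par bot b'b lt1 ulr).
have [lt2|le2] := ltnP (l2 b') (l2 b).
  have a21 : a2 <> a1 by move=> /esym.
  exact: (not_ulrich_below_bottom (facet_coordinates_sym fc) ext2 ext1 a21
    (fundamental_parallelepiped_sym par) bot b'b lt2 ulr).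
have [f Hf b'E] := facet_le fc Hb Hb' le1 le2.
have [b0|f0] : b = 0%MM \/ f = 0%MM.
  by apply: minimal_generating_set_indecomposable minB Hb Hf _; rewrite -b'E.
  by move: b1; rewrite b0 (proj1 (facet0 fc)).
by apply: b'b; rewrite b'E f0 addm0.
Qed.
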